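(* Let $c_1,c_2,c_3,c_4$ be positive constants with $c_3\ge c_4$. There exist a universal constant $A<\infty$, and constants $d_0<\infty$ and $M_0\in(2,\infty)$ depending only on $c_1,c_2,c_3,c_4$, such that the following holds for all $d\ge d_0$. Let $Z_1,\dots,Z_n$ be independent $\{0,1\}$-valued random variables with $\mathbb{P}(Z_i=1)=\frac{e^{\langle x_i,\theta_\star\rangle}}{1+e^{\langle x_i,\theta_\star\rangle}}$, $i=1,\dots,n$, for some $\theta_\star\in\mathbb{R}^d$ and $x_1,\dots,x_n\in\mathbb{R}^d$, and write $Z=(Z_1,\dots,Z_n)$. Suppose that the prior weights satisfy $\pi_\delta=g_{\|\delta\|_0}\binom{d}{\|\delta\|_0}^{-1}$, $\delta\in\{0,1\}^d$, for a probability distribution $\{g_s,\,0\le s\le d\}$ with $\frac{c_1}{d^{c_3}}g_{s-1}\le g_s\le\frac{c_2}{d^{c_4}}g_{s-1}$, $s=1,\dots,d$. Let $\rho=4\|X\|_\infty\sqrt{n\log(d)}$, $s_\star=\|\theta_\star\|_0$, $$\zeta=s_\star+\frac{2}{c_4}+\frac{2}{c_4}\left(1+\frac{64\|X\|_\infty^2}{\underline{\kappa}_1}+\frac{\bar\kappa_1(s_\star)}{64\|X\|_\infty^2(\log(d))^2}+\frac{\log(4e)}{\log(d)}\right)s_\star,$$ and $\bar s=\lceil s_\star+\zeta\rceil$. If $\underline{\kappa}:=\min(\underline{\kappa}_1,\underline{\kappa}_1(\bar s))>0$ and $$n\ge A\|X\|_\infty^4\left(\frac{s_\star}{\underline{\kappa}}\right)^2\log(d),$$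 then: (1) $\displaystyle\mathbb{E}^{(n)}\left[\check\Pi_{n,d}\left(\{\theta\in\mathbb{R}^d:\|\theta\|_0\ge\zeta\}\,|\,Z\right)\right]\le\frac4d.$ (2) $\displaystyle\mathbb{E}^{(n)}\left[\check\Pi_{n,d}\left(\left\{\theta\in\mathbb{R}^d:\|\theta-\theta_\star\|_2>\frac{M_0\|X\|_\infty}{\underline{\kappa}_1(\bar s)}\sqrt{\frac{\bar s\log(d)}{n}}\right\}\Big|\,Z\right)\right]\le\frac{12}{d}.$
   Context: Posterior: with $g(x)=\log(1+e^x)$, $x\in\mathbb{R}$, the posterior distribution is the random probability measure on $\mathbb{R}^d$ $$\check\Pi_{n,d}(d\theta|Z)\propto\exp\left(\sum_{i=1}^n\left[Z_i\langle x_i,\theta\rangle-g(\langle x_i,\theta\rangle)\right]\right)\sum_{\delta\in\{0,1\}^d}\pi_\delta\left(\frac\rho2\right)^{\|\delta\|_0}e^{-\rho\|\theta\|_1}\mu_{d,\delta}(d\theta),$$ where $\mu_{d,\delta}(d\theta)=\prod_{j=1}^d\nu_{\delta_j}(d\theta_j)$, $\nu_0$ being the Dirac mass at $0$ and $\nu_1$ Lebesgue measure on $\mathbb{R}$. $\mathbb{E}^{(n)}$ is expectation under the law of $Z$ (with parameter $\theta_\star$). Notation: $\langle\cdot,\cdot\rangle$ is the Euclidean inner product; $\|\theta\|_0$ is the number of nonzero components, $\|\cdot\|_1,\|\cdot\|_2$ the usual norms, $\theta\cdot\delta$ the componentwise product, $\lceil\cdot\rceil$ the ceiling, and a prime on a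 vector or matrix denotes transpose. $X\in\mathbb{R}^{n\times d}$ is the (deterministic) design matrix whose $i$-th row is $x_i'$, and $\|X\|_\infty=\max_{i,j}|X_{ij}|$. $\delta_\star\in\{0,1\}^d$ is given by $\delta_{\star j}=1$ if $\theta_{\star j}\ne0$ and $0$ otherwise, and $\delta_\star^c=1-\delta_\star$. $W\in\mathbb{R}^{n\times n}$ is diagonal with $W_{ii}=g^{(2)}(\langle x_i,\theta_\star\rangle)$, $g^{(2)}$ being the second derivative of $g$. Restricted eigenvalues: $$\underline{\kappa}_1=\inf\left\{\frac{\theta'(X'WX)\theta}{n\|\theta\|_2^2}:\theta\in\mathbb{R}^d\setminus\{0\},\ \|\theta\cdot\delta_\star^c\|_1\le7\|\theta\cdot\delta_\star\|_1\right\},$$ and for $s\in\{1,\dots,d\}$, $$\bar\kappa_1(s)=\sup\left\{\frac{\theta'(X'X)\theta}{n\|\theta\|_2^2}:1\le\|\theta\|_0\le s\right\},\qquad\underline{\kappa}_1(s)=\inf\left\{\frac{\theta'(X'WX)\theta}{n\|\theta\|_2^2}:1\le\|\theta\|_0\le s\right\}.$$ *)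

(* Defs.v *)
From HB Require Import structures.
From mathcomp Require Import all_boot all_order all_algebra.
From mathcomp Require Import all_classical all_reals all_analysis.

Set Implicit Arguments.
Unset Strict Implicit.
Unset Printing Implicit Defensive.

Import Order.TTheory GRing.Theory Num.Theory.
Import numFieldNormedType.Exports.

Local Open Scope classical_set_scope.
Local Open Scope ring_scope.

(* R^d is 'cV[R]_d. The library has no sigma-algebra on matrices: they are
   given the product one, generated by the entries, exactly as the library does
   for n.-tuple T. *)
Section measurable_matrix.
Context {disp} {T : sigmaRingType disp} (m n : nat).

Definition mx_cylinders : set (set 'M[T]_(m, n)) :=
  [set C | exists i j (A : set T),
    measurable A /\ C = (fun M : 'M[T]_(m, n) => M i j) @^-1` A].

Let mx_set0 : <<s mx_cylinders >> set0.
Proof. exact: sigma_algebra0. Qed.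

Let mx_setC A : <<s mx_cylinders >> A -> <<s mx_cylinders >> (~` A).
Proof. exact: sigma_algebraC. Qed.

Let mx_bigcup (F : (set _)^nat) : (forall i, <<s mx_cylinders >> (F i)) ->
  <<s mx_cylinders >> (\bigcup_i (F i)).
Proof. exact: sigma_algebra_bigcup. Qed.

HB.instance Definition _ := @isMeasurable.Build (measure_tuple_display disp)
  'M[T]_(m, n) <<s mx_cylinders >> mx_set0 mx_setC mx_bigcup.

End measurable_matrix.

Lemma measurable_mx_entry disp (T : sigmaRingType disp) m n i j :
  measurable_fun [set: 'M[T]_(m, n)] (fun M => M i j).
Proof.
move=> _ A mA; rewrite setTI; apply: sub_sigma_algebra.
by exists i, j, A.
Qed.

Lemma measurable_fun_mxP disp disp' (S : measurableType disp)
    (T : measurableType disp') m n (f : S -> 'M[T]_(m, n)) :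
  (forall i j, measurable_fun [set: S] (fun x => f x i j)) ->
  measurable_fun [set: S] f.
Proof.
move=> mf; apply: (@measurability _ _ _ _ _ _ (@mx_cylinders _ T m n)) => //.
move=> _ [_ [i [j [A [mA ->]]]] <-].
by have := mf i j measurableT A mA.
Qed.

Section spike_slab_base.
Context {R : realType}.
Local Notation mR := (measurableTypeR R).

Definition nu (b : bool) : {sigma_finite_measure set mR -> \bar R} :=
  if b then (lebesgue_measure : {sigma_finite_measure set mR -> \bar R})
  else (\d_(0 : mR) : {sigma_finite_measure set mR -> \bar R}).

Definition mx_cons d (p : mR * 'cV[R]_d) : 'cV[R]_d.+1 :=
  \col_(j < d.+1) oapp (fun k => p.2 k 0) (p.1 : R) (unlift ord0 j).

Definition mx_uncons d (v : 'cV[R]_d.+1) : mR * 'cV[R]_d :=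
  (v ord0 0, \col_(j < d) v (lift ord0 j) 0).

Lemma mx_consK d : cancel (@mx_cons d) (@mx_uncons d).
Proof.
move=> [x v]; congr (_, _); first by rewrite mxE unlift_none.
by apply/colP => j; rewrite !mxE liftK.
Qed.

Lemma measurable_mx_cons d : measurable_fun [set: mR * 'cV[R]_d] (@mx_cons d).
Proof.
apply: measurable_fun_mxP => i j.
under [F in measurable_fun _ F]eq_fun do rewrite mxE.
case: (unlift ord0 i) => [k|] /=.
  apply: (@measurableT_comp _ _ _ _ _ _ (fun v : 'cV[R]_d => v k 0)) => //.
  exact: measurable_mx_entry.
exact: (@measurable_fst _ _ mR 'cV[R]_d).
Qed.

Lemma measurable_mx_uncons d : measurable_fun [set: 'cV[R]_d.+1] (@mx_uncons d).
Proof.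
apply/measurable_fun_pairP; split; first exact: (@measurable_mx_entry _ R).
apply: measurable_fun_mxP => i j.
under [F in measurable_fun _ F]eq_fun do rewrite mxE.
exact: measurable_mx_entry.
Qed.

Section cons_measure.
Local Open Scope ereal_scope.
Context (d : nat) (m1 : {sigma_finite_measure set mR -> \bar R})
  (m2 : {sigma_finite_measure set 'cV[R]_d -> \bar R}).

Definition cons_measure : set 'cV[R]_d.+1 -> \bar R :=
  pushforward (m1 \x m2) (@mx_cons d).

Let pre A : measurable A -> measurable (@mx_cons d @^-1` A).
Proof. by move=> mA; have := @measurable_mx_cons d measurableT A mA; rewrite setTI. Qed.

Let cons_measure0 : cons_measure set0 = 0.
Proof. by rewrite /cons_measure /pushforward preimage_set0 measure0. Qed.

Let cons_measure_ge0 A : 0 <= cons_measure A.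
Proof. by rewrite /cons_measure /pushforward; exact: measure_ge0. Qed.

Let cons_measure_sigma_additive : semi_sigma_additive cons_measure.
Proof.
move=> F mF tF mUF; rewrite /cons_measure /pushforward preimage_bigcup.
apply: measure_semi_sigma_additive.
- by move=> k; exact: pre.
- apply/trivIsetP => /= i j _ _ ij; rewrite -preimage_setI.
  by move/trivIsetP : tF => /(_ _ _ _ _ ij) ->//; rewrite preimage_set0.
- by rewrite -preimage_bigcup; exact: pre.
Qed.

HB.instance Definition _ := isMeasure.Build _ _ _ cons_measure
  cons_measure0 cons_measure_ge0 cons_measure_sigma_additive.

Let cons_measure_sigma_finite : sigma_finite setT cons_measure.
Proof.
have /sigma_finiteP[F [TF ndF Foo]] := sigma_finiteT m1.
have /sigma_finiteP[G [TG ndG Goo]] := sigma_finiteT m2.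
exists (fun k => @mx_uncons d @^-1` (F k `*` G k)).
  rewrite -preimage_bigcup -[LHS](preimage_setT (@mx_uncons d)); congr (_ @^-1` _).
  rewrite -setXTT TF TG; apply/seteqP; split => [[x y] [[k _ Fx] [l _ Gy]]|].
    exists (maxn k l) => //; split.
      by have /subsetPset := ndF _ _ (leq_maxl k l); exact.
    by have /subsetPset := ndG _ _ (leq_maxr k l); exact.
  by move=> [x y] [k _ [Fx Gy]]; split; exists k.
move=> k; have [mF Fk] := Foo k; have [mG Gk] := Goo k; split.
  have := @measurable_mx_uncons d measurableT _ (measurableX mF mG).
  by rewrite setTI.
rewrite /cons_measure /pushforward -comp_preimage.
rewrite (_ : _ \o _ = id); last by apply/funext => p /=; exact: mx_consK.
by rewrite preimage_id product_measure1E// lte_mul_pinfty// ge0_fin_numE.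
Qed.

HB.instance Definition _ := Measure_isSigmaFinite.Build _ _ _ cons_measure
  cons_measure_sigma_finite.

End cons_measure.

(* The product measure nu_{delta_1} x ... x nu_{delta_d} on R^d. *)
Fixpoint mu d : ('I_d -> bool) -> {sigma_finite_measure set 'cV[R]_d -> \bar R} :=
  match d with
  | 0 => fun _ => \d_(0 : 'cV[R]_0)
  | d'.+1 => fun delta =>
      cons_measure (nu (delta ord0)) (mu (fun j : 'I_d' => delta (lift ord0 j)))
  end.

Lemma mu_box d (delta : 'I_d -> bool) (A : 'I_d -> set mR) :
  (forall j, measurable (A j)) ->
  mu delta [set v | forall j, A j (v j 0)] = (\prod_(j < d) nu (delta j) (A j))%E.
Proof.
elim: d delta A => [|d IH] delta A mA.
  by rewrite big_ord0 /= diracE mem_set//= => -[].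
have mB : measurable [set v : 'cV[R]_d | forall j, A (lift ord0 j) (v j 0)].
  rewrite (_ : [set _ | _] = \bigcap_(j in [set: 'I_d])
    ((fun v : 'cV[R]_d => v j 0) @^-1` A (lift ord0 j))); last first.
    by apply/seteqP; split => v /= H j; [move=> _|]; exact: H.
  apply: fin_bigcap_measurable => // j _.
  have := @measurable_mx_entry _ R d 1 j 0 measurableT _ (mA (lift ord0 j)).
  by rewrite setTI.
rewrite big_ord_recl /= -(IH (fun j => delta (lift ord0 j)))//.
rewrite -product_measure1E//.
rewrite /cons_measure /pushforward; congr (_ _).
apply/seteqP; split => [[x v] /= H|[x v] /= [Ax Av] j].
  split; first by have := H ord0; rewrite mxE unlift_none.
  by move=> j; have := H (lift ord0 j); rewrite mxE liftK.
rewrite mxE; case: unliftP => [k ->|->] //=; exact: Av.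
Qed.

End spike_slab_base.

Section vectors.
Context {R : realType} {d : nat}.
Implicit Types (theta : 'cV[R]_d) (delta : {ffun 'I_d -> bool}).

Definition l0norm theta : nat := #|[set j | theta j 0 != 0]%SET|.
Definition l1norm theta : R := \sum_(j < d) `|theta j 0|.
Definition l2norm theta : R := Num.sqrt (\sum_(j < d) theta j 0 ^+ 2).

Definition wt delta : nat := #|[set j | delta j]%SET|.
Definition mask theta delta : 'cV[R]_d := \col_j (theta j 0 * (delta j)%:R).
Definition supp theta : {ffun 'I_d -> bool} := [ffun j => theta j 0 != 0].
Definition compl delta : {ffun 'I_d -> bool} := [ffun j => ~~ delta j].

End vectors.

Definition glogit {R : realType} (x : R) : R := ln (1 + expR x).

Section model.
Context {R : realType} {n d : nat}.
Implicit Types (X : 'M[R]_(n, d)) (theta theta_s : 'cV[R]_d).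

(* (X *m theta) i 0 is <x_i, theta>. *)
Definition loglik X (z : 'I_n -> bool) theta : R :=
  \sum_(i < n) ((z i)%:R * (X *m theta) i 0 - glogit ((X *m theta) i 0)).

Definition post_mass X (pi_ : {ffun 'I_d -> bool} -> R) (rho : R)
    (z : 'I_n -> bool) (B : set 'cV[R]_d) : \bar R :=
  (\sum_(delta : {ffun 'I_d -> bool})
    (pi_ delta * (rho / 2) ^+ wt delta)%:E *
    \int[mu delta]_(theta in B)
      (expR (loglik X z theta) * expR (- (rho * l1norm theta)))%:E)%E.

(* When rho > 0 the masses are finite, since loglik <= 0. *)
Definition posterior X pi_ rho z B : R :=
  fine (post_mass X pi_ rho z B) / fine (post_mass X pi_ rho z setT).

Definition Wmx X theta_s : 'M[R]_n :=
  diag_mx (\row_(i < n) derive1n 2 (@glogit R) ((X *m theta_s) i 0)).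

Definition quad (M : 'M[R]_d) theta : R := (theta^T *m M *m theta) 0 0.

Definition rayleigh (M : 'M[R]_d) theta : R :=
  quad M theta / (n%:R * l2norm theta ^+ 2).

(* Infimum and supremum are taken in the extended reals: the infimum over the
   empty set (case theta_s = 0 of kappa1_cone) is +oo. *)
Definition kappa1_cone X theta_s : \bar R :=
  ereal_inf [set (rayleigh (X^T *m Wmx X theta_s *m X) theta)%:E | theta in
    [set theta | theta != 0 /\
      l1norm (mask theta (compl (supp theta_s))) <=
        7 * l1norm (mask theta (supp theta_s))]].

Definition kappa1_upper X (s : nat) : \bar R :=
  ereal_sup [set (rayleigh (X^T *m X) theta)%:E | theta in
    [set theta | (1 <= l0norm theta <= s)%N]].

Definition kappa1_lower X theta_s (s : nat) : \bar R :=
  ereal_inf [set (rayleigh (X^T *m Wmx X theta_s *m X) theta)%:E | theta in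
    [set theta | (1 <= l0norm theta <= s)%N]].

(* For theta_s != 0, kappa1_cone and kappa1_upper X (l0norm theta_s) are finite. For
   theta_s = 0 they are +oo and -oo, but the last term vanishes as it has the
   factor l0norm theta_s, whatever the value of fine. *)
Definition zeta (c4 : R) X theta_s : R :=
  let s : R := (l0norm theta_s)%:R in
  s + 2 / c4 + 2 / c4 *
    (1 + 64 * mx_norm X ^+ 2 / fine (kappa1_cone X theta_s)
       + fine (kappa1_upper X (l0norm theta_s))
           / (64 * mx_norm X ^+ 2 * ln d%:R ^+ 2)
       + ln (4 * expR 1) / ln d%:R) * s.

(* The ceiling is taken of a nonnegative real. *)
Definition sbar (c4 : R) X theta_s : nat :=
  `|Num.ceil ((l0norm theta_s)%:R + zeta c4 X theta_s)|%N.

End model.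

Definition mutually_independent {disp disp' : measure_display}
    {T : measurableType disp} {T' : measurableType disp'} {R : realType}
    (P : probability T R) {n : nat} (Z : 'I_n -> {RV P >-> T'}) : Prop :=
  forall (J : {set 'I_n}) (A : 'I_n -> set T'),
    (forall i, measurable (A i)) ->
    P (\bigcap_(i in [set` J]) Z i @^-1` A i) = (\prod_(i in J) P (Z i @^-1` A i))%E.

(* Main.v *)
(** Write [u = theta - theta_s] and let [D u] be the Bregman divergence of the
negative log-likelihood at [theta_s]. By Hoeffding's inequality the entries of
the score are at most [rho / 4] with probability at least [1 - 2 / d]. On that
event, the log-likelihood ratio plus the change in the l1 penalty is at most
[- rho / 2 |u|_1 + 7 / 4 rho |u_S|_1 - rho / 4 |u_Sc|_1 - D u], where [S] is
the support of [theta_s] and [Sc] its complement.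
Self-concordance of the logistic loss gives
[D u >= u' X' W X u / (2 + |X|_oo |u|_1)]. Outside the cone of [kappa1_cone]
the l1 terms alone control the exponent, inside it the restricted eigenvalue
does. The factor [exp (- a |u|_1)] left over integrates to at most
[(2 / a) ^ |delta|_0] against each slab, which cancels [(rho / 2) ^ |delta|_0] up to
a constant power, so that the prior on the model size decides. The normalizing
constant is bounded below by the mass of a small box around [theta_s] in the
model [S]. *)

Require Import Defs.
From HB Require Import structures.
From mathcomp Require Import all_boot all_order all_algebra.
From mathcomp Require Import all_classical all_reals all_analysis.
From mathcomp Require Import measurable_realfun ring lra.

Set Implicit Arguments.
Unset Strict Implicit.
Unset Printing Implicit Defensive.

Import Order.TTheory GRing.Theory Num.Theory.
Import numFieldNormedType.Exports.

Local Open Scope classical_set_scope.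
Local Open Scope ring_scope.

(** * Scalar calculus of the logistic function and its Bregman divergence *)

Section scalar.
Context {R : realType}.
Implicit Types x h : R.

(** The lower bound on [D] is quadratic for small [u] but only linear once [|X|_oo |u|_1] is large,
    so that a restricted eigenvalue alone does not dominate the l1 terms. The sample-size condition
    makes the slope of the linear regime exceed theirs; this is where the constant 140, and hence
    [A], comes from. Off the cone [|u|_1] is not controlled by the l2 norm; there [D] is paired with
    the leftover l1 term, because [|u|_1] cancels in the product of their lower bounds. The two
    claims keep different fractions of the penalty for the integration: [rho / 2] for the model size
    and [rho / 4] for the l2 norm, which costs a factor 2 or 4 per active coordinate. Of the prior
    decay [d^(- c4)] per extra coordinate, one half absorbs this factor and leaves a geometric
    series, the other half supplies the tail. [zeta] is the size at which that tail pays for all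
    losses and still leaves a factor [1 / d]. The l2 claim rests on the first one, since
    [kappa1_lower] only sees sparse differences. *)

Lemma is_derive_ge0_le (f f' : R -> R) (a b : R) : a <= b ->
  (forall x, a <= x -> is_derive x 1 f (f' x)) ->
  (forall x, a <= x -> 0 <= f' x) -> f a <= f b.
Proof.
move=> ab df f'0; move: ab; rewrite le_eqVlt => /predU1P[-> //|ab].
have cf : {within `[a, b], continuous f}.
  apply: derivable_within_continuous => x; rewrite in_itv/= => /andP[ax _].
  by have [] := df x ax.
have [|c] := MVT (f := f) (df := f') ab _ cf.
  by move=> x; rewrite in_itv/= => /andP[/ltW ax _]; exact: df.
rewrite in_itv/= => /andP[/ltW ac _] fab.
by rewrite -subr_ge0 fab mulr_ge0 ?f'0// subr_ge0 ltW.
Qed.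

Definition sigmoid x : R := expR x / (1 + expR x).

(* The Bregman divergence of [glogit], which is also the log-moment generating function
   at [h] of a centered Bernoulli variable of parameter [sigmoid x]. *)
Definition breg x h : R := glogit (x + h) - glogit x - sigmoid x * h.

Lemma onePexpR_gt0 x : 0 < 1 + expR x.
Proof. by rewrite addr_gt0// expR_gt0. Qed.

Lemma is_derive_onePexpR x : is_derive x 1 (fun y : R => 1 + expR y) (expR x).
Proof.
have := @is_deriveD R R^o R^o (cst 1) expR x 1 0 (expR x) _ _.
by rewrite add0r; exact.
Qed.

Lemma sigmoid_gt0 x : 0 < sigmoid x.
Proof. by rewrite divr_gt0 ?expR_gt0// onePexpR_gt0. Qed.

Lemma onem_sigmoid x : 1 - sigmoid x = (1 + expR x)^-1.
Proof. by rewrite /sigmoid; field; rewrite gt_eqF// onePexpR_gt0. Qed.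

Lemma sigmoid_lt1 x : sigmoid x < 1.
Proof. by rewrite -subr_gt0 onem_sigmoid invr_gt0 onePexpR_gt0. Qed.

Lemma is_derive_glogit x : is_derive x 1 (@glogit R) (sigmoid x).
Proof.
have d1 := is_derive_onePexpR x.
rewrite /sigmoid mulrC.
have d2 := @is_derive1_ln R _ (onePexpR_gt0 x).
exact: (@is_derive1_comp R (@ln R) (fun y : R => 1 + expR y) _ _ _ d2 d1).
Qed.

Lemma is_derive_sigmoid x :
  is_derive x 1 sigmoid (sigmoid x * (1 - sigmoid x)).
Proof.
have n0 := onePexpR_gt0 x.
have -> : sigmoid = (expR * (fun y => (1 + expR y)^-1)).
  by apply/funext => y.
have d1 := is_derive_onePexpR x.
have d2 := @is_deriveV _ (fun y : R => 1 + expR y) x (expR x) 1 (lt0r_neq0 n0) d1.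
apply: is_derive_eq => /=.
rewrite /sigmoid/GRing.scale/= /GRing.mul_fun /=.
by rewrite !fctE; field; rewrite gt_eqF.
Qed.

Lemma derive1n2_glogit x :
  derive1n 2 (@glogit R) x = sigmoid x * (1 - sigmoid x).
Proof.
rewrite derive1nS derive1n1.
have -> : derive1 (glogit : R -> R) = sigmoid.
  apply/funext => y; rewrite derive1E; apply: derive_val.
  exact: is_derive_glogit.
by rewrite derive1E; apply: derive_val; exact: is_derive_sigmoid.
Qed.

Lemma is_derive_breg x h : is_derive h 1 (breg x) (sigmoid (x + h) - sigmoid x).
Proof.
have d0 : is_derive h 1 (fun h : R => x + h) 1.
  by have := @is_deriveD R R^o R^o (cst x) id h 1 0 1 _ _; rewrite add0r; exact.
have := @is_derive1_comp R (@glogit R) (fun h : R => x + h) _ _ _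
  (is_derive_glogit _) d0.
rewrite mulr1 => d1.
have d2 : is_derive h 1 (fun h : R => sigmoid x * h) (sigmoid x).
  have := @is_deriveZ R R^o R^o id (sigmoid x) h 1 1 _.
  by rewrite [_ *: 1]mulr1; exact.
have d3 := @is_deriveB R R^o R^o _ (cst (glogit x)) h 1 _ _ d1 (is_derive_cst _ _ _).
have := @is_deriveB R R^o R^o _ _ h 1 _ _ d3 d2.
by rewrite subr0; exact.
Qed.

Lemma sigmoidN x : sigmoid (- x) = 1 - sigmoid x.
Proof.
rewrite onem_sigmoid /sigmoid expRN; field.
by rewrite !gt_eqF// ?expR_gt0// onePexpR_gt0.
Qed.

Lemma glogitN x : glogit (- x) = glogit x - x.
Proof.
rewrite /glogit -[in RHS](expRK x) expRN -ln_div ?posrE ?expR_gt0 ?onePexpR_gt0//.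
by congr ln; rewrite expRK; field; rewrite gt_eqF// expR_gt0.
Qed.

(** Exchanging success and failure is a symmetry of the model. It reduces the two bounds on [breg]
    below to increments [h >= 0]. *)
Lemma bregN x h : breg (- x) (- h) = breg x h.
Proof. by rewrite /breg -opprD !glogitN sigmoidN; ring. Qed.

Lemma breg0 x : breg x 0 = 0.
Proof. by rewrite /breg addr0; ring. Qed.

(** Self-concordance integrated once: the third derivative of [glogit] is at least minus the second,
    so the second derivative decays at most like [exp (- t)], whose integral is [1 - exp (- h)].
    Here the difference of the two sides is an explicit square over a positive denominator. *)
Lemma sigmoidD_ge x h : 0 <= h ->
  sigmoid x * (1 - sigmoid x) * (1 - expR (- h)) <= sigmoid (x + h) - sigmoid x.
Proof.
move=> h0; rewrite onem_sigmoid /sigmoid expRN expRD.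
set E := expR x; set H := expR h.
have E0 : 0 < E by exact: expR_gt0.
have H1 : 1 <= H by rewrite -expR0 ler_expR.
have H0 : 0 < H by exact: lt_le_trans H1.
have EH0 : 0 < 1 + E * H by rewrite addr_gt0// mulr_gt0.
have E10 : 0 < 1 + E by rewrite addr_gt0.
rewrite -subr_ge0 (_ : _ - _ =
    E * (H - 1) ^+ 2 / (H * (1 + E * H) * (1 + E) ^+ 2)); last first.
  by field; rewrite !gt_eqF.
apply: divr_ge0; first by rewrite mulr_ge0 ?sqr_ge0// ltW.
by rewrite ltW// mulr_gt0 ?exprn_gt0// mulr_gt0.
Qed.

Lemma sigmoidD_le x h : 0 <= h -> sigmoid (x + h) - sigmoid x <= h / 4.
Proof.
move=> h0; rewrite -subr_ge0.
have d0 (k : R) : is_derive k 1 (fun h : R => x + h) 1.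
  by have := @is_deriveD R R^o R^o (cst x) id k 1 0 1 _ _; rewrite add0r; exact.
have d1 k := @is_derive1_comp R (@sigmoid) (fun h : R => x + h) k _ _
  (is_derive_sigmoid _) (d0 k).
have d2 k := @is_deriveB R R^o R^o _ (cst (sigmoid x)) k 1 _ _ (d1 k)
  (is_derive_cst _ _ _).
have d3 (k : R) : is_derive k 1 (fun h : R => 4^-1 * h) 4^-1.
  have := @is_deriveZ R R^o R^o id 4^-1 k 1 1 _.
  by rewrite [_ *: 1]mulr1; exact.
have d4 k := @is_deriveB R R^o R^o _ _ k 1 _ _ (d3 k) (d2 k).
have := is_derive_ge0_le h0 (fun k _ => d4 k).
rewrite /= /GRing.add_fun/GRing.opp_fun/= !fctE/= mulr0 addr0 subrr subr0 mulrC; apply=> k _.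
rewrite subr0 mulr1 -subr_ge0.
rewrite (_ : _ - _ = (sigmoid (x + k) - 2^-1) ^+ 2); last by field.
exact: sqr_ge0.
Qed.

(** Hoeffding's lemma for a Bernoulli variable. It is used twice: for the tails of the score, and to
    bound the divergence from above on the box of the normalizing constant. *)
Lemma breg_le x h : breg x h <= h ^+ 2 / 8.
Proof.
wlog h0 : x h / 0 <= h => [wh|].
  have [|/ltW h0] := leP 0 h; first exact: wh.
  by rewrite -bregN -sqrrN; apply: wh; rewrite oppr_ge0.
rewrite -subr_ge0.
have d1 (k : R) : is_derive k 1 (fun h : R => 8^-1 * h ^+ 2) (k / 4).
  have := @is_deriveZ R R^o R^o _ 8^-1 k 1 _ (@is_deriveX R R^o id 2 k 1 1 _).
  move=> /(_ (is_derive_id _ _)) d.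
  have -> : k / 4 = 8^-1 *: (2 * k ^+ 2.-1)%:A.
    by rewrite /GRing.scale/= expr1; field.
  exact: d.
have d4 k := @is_deriveB R R^o R^o _ _ k 1 _ _ (d1 k) (is_derive_breg x k).
have := is_derive_ge0_le h0 (fun k _ => d4 k).
rewrite /= /GRing.add_fun/GRing.opp_fun/= !fctE/= breg0 expr0n/= mulr0 subr0 mulrC; apply=> k k0.
by rewrite subr_ge0 sigmoidD_le.
Qed.

(** Integrating [sigmoidD_ge] gives the factor [exp (- h) + h - 1], which is at least
    [h ^+ 2 / (2 + h)]: quadratic near 0 and linear at infinity, like [breg] itself. *)
Lemma breg_ge x h :
  sigmoid x * (1 - sigmoid x) * h ^+ 2 / (2 + `|h|) <= breg x h.
Proof.
wlog h0 : x h / 0 <= h => [wh|].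
  have [|/ltW h0] := leP 0 h; first exact: wh.
  rewrite -bregN -sqrrN -(normrN h); have := wh (- x) (- h).
  by rewrite sigmoidN oppr_ge0 => /(_ h0); rewrite (_ : _ * (1 - _) = sigmoid x * (1 - sigmoid x))//; ring.
rewrite ger0_norm//.
set p := sigmoid x * (1 - sigmoid x).
have p0 : 0 <= p by rewrite mulr_ge0// ltW// ?sigmoid_gt0// subr_gt0 sigmoid_lt1.
have dN (k : R) : is_derive k 1 (fun h : R => expR (- h)) (- expR (- k)).
  have := @is_derive1_comp R (@expR R) -%R k _ _ (is_derive_expR _) (is_deriveNid _ _).
  by rewrite mulrN1.
have did (k : R) := @is_derive_id R R^o k 1.
have d1 k := @is_deriveD R R^o R^o _ _ k 1 _ _ (dN k) (did k).
have d2 k := @is_deriveB R R^o R^o _ (cst (1 : R)) k 1 _ _ (d1 k) (is_derive_cst _ _ _).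
have d3 k := @is_deriveZ R R^o R^o _ p k 1 _ (d2 k).
have d4 k := @is_deriveB R R^o R^o _ _ k 1 _ _ (is_derive_breg x k) (d3 k).
have := is_derive_ge0_le h0 (fun k _ => d4 k).
rewrite /= /GRing.add_fun/GRing.opp_fun/= !fctE/= breg0 oppr0 expR0 addr0 subrr [p *: 0]mulr0 subr0.
move=> H; have {H} H : p * (expR (- h) + h - 1) <= breg x h.
  rewrite -subr_ge0; apply: H => k k0; rewrite addr0 subr_ge0.
  by apply: le_trans (sigmoidD_ge x k0); rewrite /GRing.scale/= [- _ + 1]addrC.
apply: le_trans H; rewrite -mulrA; apply: ler_wpM2l => //.
rewrite ler_pdivrMr; last by lra.
have d5 (k : R) := @is_deriveD R R^o R^o (cst (2 : R)) id k 1 _ _ (is_derive_cst _ _ _) (did k).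
have d6 k := @is_deriveM R R^o _ _ k 1 _ _ (d5 k) (dN k).
have d7 k := @is_deriveD R R^o R^o _ _ k 1 _ _ (d6 k) (did k).
have := is_derive_ge0_le h0 (fun k _ => d7 k).
rewrite /= /GRing.add_fun/GRing.mul_fun/= !fctE/= oppr0 expR0 !addr0 mulr1.
move=> H; rewrite -subr_ge0; set e := expR _.
(* This is [h ^+ 2 <= (2 + h) * (e + h - 1)] expanded. Equality holds at 0, and the right-hand side
   has derivative [1 - (1 + h) * exp (- h) >= 0]. *)
suff : 2 <= (2 + h) * e + h by nra.
apply: H => k k0; rewrite /GRing.scale/= add0r mulr1.
have : (1 + k) * expR (- k) <= 1.
  by rewrite expRN ler_pdivrMr ?expR_gt0// mul1r expR_ge1Dx.
set ek := expR _; lra.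
Qed.

Lemma breg_ge0 x h : 0 <= breg x h.
Proof.
apply: le_trans (breg_ge x h); rewrite divr_ge0 ?addr_ge0// mulr_ge0 ?sqr_ge0//.
by rewrite mulr_ge0// ltW// ?sigmoid_gt0// subr_gt0 sigmoid_lt1.
Qed.

Lemma expR_breg x h : expR (breg x h) =
  ((1 - sigmoid x) + sigmoid x * expR h) * expR (- (sigmoid x * h)).
Proof.
rewrite /breg expRD; congr (_ * _).
rewrite expRB !lnK ?posrE ?onePexpR_gt0// onem_sigmoid /sigmoid expRD; field.
by rewrite gt_eqF// onePexpR_gt0.
Qed.

End scalar.

(** * Norms, supports and Cauchy-Schwarz *)

Section vectors.
Context {R : realType} {d : nat}.
Implicit Types (u v : 'cV[R]_d) (A : {set 'I_d}) (delta : {ffun 'I_d -> bool}).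

(** Cauchy-Schwarz against the constant vector, read off from the sum of squared deviations from the
    mean, scaled by [m] to avoid a division. *)
Lemma sqr_sum_le A (a : 'I_d -> R) :
  (\sum_(j in A) a j) ^+ 2 <= #|A|%:R * \sum_(j in A) a j ^+ 2.
Proof.
set S := \sum_(j in A) a j; set m : R := #|A|%:R.
have [/eqP A0|A0] := eqVneq #|A| 0%N.
  rewrite cards_eq0 in A0; rewrite /S (eqP A0) !big_set0 expr0n/=.
  by rewrite mulr0.
have m0 : 0 < m by rewrite ltr0n lt0n.
have : 0 <= \sum_(j in A) (m * a j - S) ^+ 2 by rewrite sumr_ge0// => j _; exact: sqr_ge0.
have -> : \sum_(j in A) (m * a j - S) ^+ 2 =
    m * (m * \sum_(j in A) a j ^+ 2 - S ^+ 2).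
  transitivity (\sum_(j in A) (m ^+ 2 * a j ^+ 2 - 2 * m * S * a j + S ^+ 2)).
    by apply: eq_bigr => j _; ring.
  rewrite big_split/= sumrB -!mulr_sumr -/S sumr_const -[_ *+ #|_|]mulr_natl -/m.
  by ring.
by rewrite pmulr_rge0// subr_ge0.
Qed.

Lemma l2norm_ge0 u : 0 <= l2norm u.
Proof. exact: sqrtr_ge0. Qed.

Lemma l1norm_ge0 u : 0 <= l1norm u.
Proof. exact: sumr_ge0. Qed.

Lemma sqr_l2norm u : l2norm u ^+ 2 = \sum_(j < d) u j 0 ^+ 2.
Proof. by rewrite sqr_sqrtr// sumr_ge0// => j _; exact: sqr_ge0. Qed.

Lemma sum_norm_le A u :
  \sum_(j in A) `|u j 0| <= Num.sqrt #|A|%:R * l2norm u.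
Proof.
rewrite -ler_sqr ?nnegrE ?sumr_ge0 ?mulr_ge0 ?sqrtr_ge0//.
rewrite exprMn sqr_sqrtr// sqr_l2norm; apply: le_trans (sqr_sum_le _ _) _.
apply: ler_wpM2l => //.
rewrite [leRHS](bigID (mem A))/=.
under eq_bigr do rewrite real_normK ?num_real//.
by rewrite lerDl sumr_ge0// => j _; exact: sqr_ge0.
Qed.

Lemma l2norm_le_l1norm u : l2norm u <= l1norm u.
Proof.
rewrite -ler_sqr ?nnegrE ?l1norm_ge0 ?l2norm_ge0// sqr_l2norm expr2 /l1norm mulr_suml.
apply: ler_sum => j _; rewrite -real_normK ?num_real// expr2 ler_wpM2l//.
by rewrite (bigD1 j)//= lerDl sumr_ge0.
Qed.

Lemma l1norm_mask u delta :
  l1norm (Defs.mask u delta) = \sum_(j in [set j | delta j]%SET) `|u j 0|.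
Proof.
rewrite /l1norm big_mkcond/= [RHS]big_mkcond/=; apply: eq_bigr => j _.
by rewrite inE mxE; case: (delta j); rewrite ?mulr1// mulr0 normr0.
Qed.

Lemma l1norm_maskD u delta :
  l1norm u = l1norm (Defs.mask u delta) + l1norm (Defs.mask u (compl delta)).
Proof.
rewrite !l1norm_mask /l1norm (bigID (fun j => delta j))/=; congr (_ + _).
  by apply: eq_bigl => j; rewrite inE.
by apply: eq_bigl => j; rewrite !inE ffunE.
Qed.

Lemma l1norm_mask_le u delta :
  l1norm (Defs.mask u delta) <= Num.sqrt (wt delta)%:R * l2norm u.
Proof. by rewrite l1norm_mask; exact: sum_norm_le. Qed.

Lemma l1norm_le u : l1norm u <= Num.sqrt (l0norm u)%:R * l2norm u.
Proof.
apply: le_trans (sum_norm_le _ _); rewrite /l1norm big_mkcond/= [leRHS]big_mkcond/=.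
by apply: ler_sum => j _; rewrite inE; case: eqP => [->|//]/=; rewrite normr0.
Qed.

Lemma l0normB u v : (l0norm (u - v) <= l0norm u + l0norm v)%N.
Proof.
apply: leq_trans (leq_card_setU _ _); apply: subset_leq_card.
apply/fintype.subsetP => j; rewrite !inE !mxE; apply: contraR.
by rewrite negb_or !negbK => /andP[/eqP-> /eqP->]; rewrite subrr.
Qed.

Lemma wt_supp u : wt (supp u) = l0norm u.
Proof. by apply: eq_card => j; rewrite !inE ffunE. Qed.

Lemma l0norm_eq0 u : (l0norm u == 0)%N = (u == 0).
Proof.
rewrite cards_eq0; apply/eqP/eqP => [u0|->].
  apply/colP => j; rewrite mxE; apply/eqP/negbNE.
  by move/setP: u0 => /(_ j); rewrite !inE => ->.
by apply/setP => j; rewrite !inE mxE eqxx.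
Qed.

Lemma l2norm_gt0 u : (0 < l2norm u) = (u != 0).
Proof.
rewrite lt0r l2norm_ge0 andbT -sqrf_eq0 sqr_l2norm; congr negb.
apply/eqP/eqP => [u0|->]; last first.
  by rewrite big1// => j _; rewrite mxE expr0n.
apply/colP => j; rewrite mxE; apply/eqP; rewrite -sqrf_eq0; apply/eqP.
by move/psumr_eq0P: u0 => ->// i _; exact: sqr_ge0.
Qed.

(* Off the support of [v] the two sides agree; on it this is the triangle inequality. *)
Lemma l1normB_supp u v :
  l1norm v - l1norm (v + u) <=
  l1norm (Defs.mask u (supp v)) - l1norm (Defs.mask u (compl (supp v))).
Proof.
rewrite !l1norm_mask /l1norm -sumrB.
rewrite [leLHS](bigID (fun j => v j 0 != 0))/=.
rewrite [X in _ <= X - _](eq_bigl (fun j => v j 0 != 0)); last first.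
  by move=> j; rewrite inE ffunE.
rewrite [X in _ <= _ - X](eq_bigl (fun j => ~~ (v j 0 != 0))); last first.
  by move=> j; rewrite !inE !ffunE.
rewrite -sumrN lerD//; apply: ler_sum => j.
  rewrite mxE => _; rewrite lerBlDr -[leLHS]normrN.
  have := ler_normB (u j 0) (v j 0 + u j 0).
  by rewrite opprD addrCA subrr addr0.
by rewrite negbK mxE => /eqP ->; rewrite add0r normr0 sub0r.
Qed.

End vectors.

(** * Expansion of the log-likelihood and restricted eigenvalues *)

Section model.
Context {R : realType} {n d : nat}.
Variables (X : 'M[R]_(n, d)) (v : 'cV[R]_d).
Implicit Types (u : 'cV[R]_d) (z : 'I_n -> bool).

Local Notation Xn := (mx_norm X).

Lemma le_mx_norm i j : `|X i j| <= Xn.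
Proof. by rewrite mx_normrE; apply/bigmax_geP; right; exists (i, j). Qed.

Lemma mx_norm_ge0 : 0 <= Xn.
Proof. by rewrite mx_normrE; apply/bigmax_geP; left. Qed.

Lemma mulmx_le u i : `|(X *m u) i 0| <= Xn * l1norm u.
Proof.
rewrite mxE; apply: le_trans (ler_norm_sum _ _ _) _.
rewrite /l1norm mulr_sumr; apply: ler_sum => j _.
by rewrite normrM ler_wpM2r// le_mx_norm.
Qed.

Lemma quadE (D : 'M[R]_n) u (c : 'I_n -> R) : D = diag_mx (\row_i c i) ->
  quad (X^T *m D *m X) u = \sum_(i < n) c i * (X *m u) i 0 ^+ 2.
Proof.
move=> ->; rewrite /quad !mulmxA -trmx_mul -!mulmxA mxE; apply: eq_bigr => i _.
by rewrite mul_diag_mx !mxE; ring.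
Qed.

Lemma quad_gram u : quad (X^T *m X) u = \sum_(i < n) (X *m u) i 0 ^+ 2.
Proof.
rewrite /quad !mulmxA -trmx_mul -!mulmxA mxE; apply: eq_bigr => i _.
by rewrite mxE expr2.
Qed.

(** The variance of the [i]-th observation under [v], which is the [i]-th diagonal entry of
    [Wmx X v]. *)
Definition gvar (i : 'I_n) : R :=
  sigmoid ((X *m v) i 0) * (1 - sigmoid ((X *m v) i 0)).

Lemma gvar_ge0 i : 0 <= gvar i.
Proof. by rewrite mulr_ge0// ltW// ?sigmoid_gt0// subr_gt0 sigmoid_lt1. Qed.

Lemma gvar_le i : gvar i <= 4^-1.
Proof.
rewrite -subr_ge0 /gvar; set s := sigmoid _.
by rewrite (_ : _ - _ = (s - 2^-1) ^+ 2) ?sqr_ge0//; field.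
Qed.

Lemma quad_W u : quad (X^T *m Wmx X v *m X) u =
  \sum_(i < n) gvar i * (X *m u) i 0 ^+ 2.
Proof.
apply: quadE; rewrite /Wmx; congr diag_mx; apply/rowP => i.
by rewrite [LHS]mxE [RHS]mxE derive1n2_glogit.
Qed.

Lemma quad_gram_ge0 u : 0 <= quad (X^T *m X) u.
Proof. by rewrite quad_gram sumr_ge0// => i _; exact: sqr_ge0. Qed.

Lemma quad_W_le u : quad (X^T *m Wmx X v *m X) u <= quad (X^T *m X) u / 4.
Proof.
rewrite quad_W quad_gram mulr_suml; apply: ler_sum => i _.
by rewrite mulrC ler_wpM2l ?sqr_ge0// gvar_le.
Qed.

Lemma quad_gram_le u : quad (X^T *m X) u <= n%:R * (Xn * l1norm u) ^+ 2.
Proof.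
rewrite quad_gram; apply: (@le_trans _ _ (\sum_(i < n) (Xn * l1norm u) ^+ 2)).
  apply: ler_sum => i _; rewrite -[leLHS]real_normK ?num_real//.
  by rewrite ler_sqr ?nnegrE ?mulr_ge0 ?mx_norm_ge0 ?l1norm_ge0// mulmx_le.
by rewrite sumr_const card_ord mulr_natl.
Qed.

Definition divergence u : R := \sum_(i < n) breg ((X *m v) i 0) ((X *m u) i 0).

Lemma divergence_ge0 u : 0 <= divergence u.
Proof. by apply: sumr_ge0 => i _; exact: breg_ge0. Qed.

Lemma divergence_le u : divergence u <= quad (X^T *m X) u / 8.
Proof.
by rewrite quad_gram mulr_suml; apply: ler_sum => i _; exact: breg_le.
Qed.

(** All increments satisfy [|<x_i, u>| <= Xn * l1norm u], so one denominator serves every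
    observation and the weighted Gram form factors out. *)
Lemma divergence_ge u :
  quad (X^T *m Wmx X v *m X) u / (2 + Xn * l1norm u) <= divergence u.
Proof.
rewrite quad_W mulr_suml; apply: ler_sum => i _.
apply: le_trans (breg_ge _ _); apply: ler_wpM2l.
  by rewrite mulr_ge0 ?gvar_ge0 ?sqr_ge0.
by rewrite lef_pV2 ?posrE ?ltr_wpDr ?mulr_ge0 ?mx_norm_ge0 ?l1norm_ge0// lerD2l mulmx_le.
Qed.

Definition score z (j : 'I_d) : R :=
  \sum_(i < n) ((z i)%:R - sigmoid ((X *m v) i 0)) * X i j.

(** The data enter the log-likelihood linearly, so all randomness sits in the score and the
    remainder is deterministic. *)
Lemma loglikD z u : loglik X z (v + u) - loglik X z v =
  \sum_(j < d) score z j * u j 0 - divergence u.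
Proof.
have -> : \sum_(j < d) score z j * u j 0 =
    \sum_(i < n) ((z i)%:R - sigmoid ((X *m v) i 0)) * (X *m u) i 0.
  under eq_bigr do rewrite mulr_suml.
  rewrite exchange_big/=; apply: eq_bigr => i _.
  set c := _ - _; rewrite mxE mulr_sumr.
  by apply: eq_bigr => j _; rewrite mulrA.
rewrite /loglik /divergence -!sumrB; apply: eq_bigr => i _.
by rewrite mulmxDr mxE /breg; ring.
Qed.

Lemma loglik_le0 z u : loglik X z u <= 0.
Proof.
apply: sumr_le0 => i _; rewrite subr_le0; set x := (X *m u) i 0.
rewrite -ler_expR /glogit lnK ?posrE ?onePexpR_gt0//.
by case: (z i); rewrite ?mul1r ?mul0r ?expR0 ?lerDr ?lerDl// expR_ge0.
Qed.

Lemma score_le z u (c : R) : (forall j, `|score z j| <= c) ->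
  `|\sum_(j < d) score z j * u j 0| <= c * l1norm u.
Proof.
move=> sc; apply: le_trans (ler_norm_sum _ _ _) _.
rewrite /l1norm mulr_sumr; apply: ler_sum => j _.
by rewrite normrM ler_wpM2r.
Qed.

Let S := supp v.
Let uS u := l1norm (Defs.mask u S).
Let uSc u := l1norm (Defs.mask u (compl S)).

(** The score costs [rho / 4] on every coordinate and the penalty contributes [rho] on the support
    and [- rho] off it, in total [5 / 4] and [- 3 / 4]. Setting [- 1 / 2] aside on both for the
    integration leaves [7 / 4] and [- 1 / 4], whose ratio 7 is the constant of the cone. *)
Lemma loglik_penalized_le z u (rho : R) : 0 <= rho ->
  (forall j, `|score z j| <= rho / 4) ->
  loglik X z (v + u) - loglik X z v + rho * (l1norm v - l1norm (v + u)) <=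
  - (rho / 2) * l1norm u + 7 / 4 * rho * uS u - rho / 4 * uSc u - divergence u.
Proof.
move=> rho0 sc; rewrite loglikD.
have := ler_normlW (score_le u sc).
have := ler_wpM2l rho0 (l1normB_supp u v).
rewrite (l1norm_maskD u S) -/(uS u) -/(uSc u).
set a := \sum_(j < d) _; set b := rho * (_ - l1norm (v + u)).
by lra.
Qed.

Lemma loglik_penalized_ge z u (rho : R) : 0 <= rho ->
  (forall j, `|score z j| <= rho / 4) ->
  - (5 / 4 * rho * l1norm u) - quad (X^T *m X) u / 8 <=
  loglik X z (v + u) - loglik X z v + rho * (l1norm v - l1norm (v + u)).
Proof.
move=> rho0 sc; rewrite loglikD.
have /lerNnormlW := score_le u sc.
have := ler_wpM2l rho0 (_ : l1norm (v + u) <= l1norm v + l1norm u).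
have := divergence_le u.
set a := \sum_(j < d) _.
move=> h1 h2 h3; have {}h2 := h2 _; rewrite mulrDr in h2.
suff /h2 : l1norm (v + u) <= l1norm v + l1norm u by rewrite mulrBr; lra.
by rewrite /l1norm -big_split/=; apply: ler_sum => j _; rewrite mxE ler_normD.
Qed.

Lemma quad_rayleigh (D : 'M[R]_d) u : u != 0 -> (0 < n)%N ->
  quad D u = rayleigh (n := n) D u * (n%:R * l2norm u ^+ 2).
Proof.
move=> u0 n0; rewrite /rayleigh divfK// mulf_neq0 ?pnatr_eq0 ?lt0n_neq0//.
by rewrite expf_neq0// gt_eqF// l2norm_gt0.
Qed.

Lemma l1norm_delta (j : 'I_d) : l1norm (delta_mx j 0 : 'cV[R]_d) = 1.
Proof.
rewrite /l1norm (bigD1 j)//= mxE !eqxx normr1 big1 ?addr0// => k /negPf kj.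
by rewrite mxE kj normr0.
Qed.

Lemma l2norm_delta (j : 'I_d) : l2norm (delta_mx j 0 : 'cV[R]_d) = 1.
Proof.
rewrite /l2norm (bigD1 j)//= mxE !eqxx expr1n big1 ?addr0 ?sqrtr1// => k /negPf kj.
by rewrite mxE kj expr0n.
Qed.

Lemma delta_mx_neq0 (j : 'I_d) : (delta_mx j 0 : 'cV[R]_d) != 0.
Proof. by rewrite -l2norm_gt0 l2norm_delta. Qed.

Lemma l0norm_delta (j : 'I_d) : l0norm (delta_mx j 0 : 'cV[R]_d) = 1%N.
Proof.
rewrite /l0norm (_ : [set _ | _]%SET = [set j]%SET) ?cards1//.
by apply/setP => k; rewrite !inE mxE eqxx andbT; case: (k == j); rewrite ?oner_eq0 ?eqxx.
Qed.

Lemma rayleigh_W_delta_le (j : 'I_d) :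
  rayleigh (n := n) (X^T *m Wmx X v *m X) (delta_mx j 0) <= Xn ^+ 2 / 4.
Proof.
rewrite /rayleigh l2norm_delta expr1n mulr1.
have [n0|n0] := posnP n.
  by rewrite (_ : n%:R = 0) ?n0// invr0 mulr0 divr_ge0 ?sqr_ge0.
rewrite ler_pdivrMr ?ltr0n//; apply: le_trans (quad_W_le _) _.
rewrite mulrAC ler_pM2r ?invr_gt0//; apply: le_trans (quad_gram_le _) _.
by rewrite l1norm_delta mulr1 mulrC.
Qed.

(** Testing the infimum on a coordinate vector makes it finite, and ties the eigenvalue to the scale
    of the design: this is the condition [4 * k <= X ^+ 2] of [exponent_bound]. *)
Lemma kappa1_lower_le s : (0 < d)%N -> (0 < s)%N ->
  (kappa1_lower X v s <= (Xn ^+ 2 / 4)%:E)%E.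
Proof.
move=> d0 s0; pose j := Ordinal d0.
have h := rayleigh_W_delta_le j; rewrite -lee_fin in h.
apply: le_trans h; apply: ereal_inf_lbound.
by exists (delta_mx j 0) => //=; rewrite l0norm_delta.
Qed.

(** For [n = 0] every Rayleigh quotient is 0, division by 0 being 0, so a positive eigenvalue forces
    at least one observation. *)
Lemma kappa1_lower_n_gt0 s : (0 < d)%N -> (0 < s)%N ->
  (0 < kappa1_lower X v s)%E -> (0 < n)%N.
Proof.
move=> d0 s0; apply: contraTltn; rewrite leqn0 => /eqP n0; rewrite -leNgt.
pose j := Ordinal d0.
have h : (kappa1_lower X v s <=
    (rayleigh (n := n) (X^T *m Wmx X v *m X) (delta_mx j 0))%:E)%E.
  by apply: ereal_inf_lbound; exists (delta_mx j 0) => //=; rewrite l0norm_delta.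
apply: le_trans h _.
have -> : rayleigh (n := n) (X^T *m Wmx X v *m X) (delta_mx j 0) = 0.
  by rewrite /rayleigh (_ : n%:R = 0) ?n0// mul0r invr0 mulr0.
by [].
Qed.

Lemma kappa1_lower_quad s u : (0 < n)%N -> (0 < kappa1_lower X v s)%E ->
  (l0norm u <= s)%N ->
  fine (kappa1_lower X v s) * (n%:R * l2norm u ^+ 2) <= quad (X^T *m Wmx X v *m X) u.
Proof.
move=> n0 k0 us; have [->|u0] := eqVneq u 0.
  have := quad_W 0; rewrite mulmx0 => ->.
  rewrite (_ : l2norm 0 = 0) ?expr0n ?mulr0/=; last first.
    by apply/eqP; rewrite eq_le l2norm_ge0 leNgt l2norm_gt0 eqxx.
  by rewrite sumr_ge0// => i _; rewrite mulr_ge0 ?gvar_ge0 ?sqr_ge0.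
rewrite (quad_rayleigh _ u0 n0) ler_wpM2r ?mulr_ge0 ?l2norm_ge0//.
have ku : (kappa1_lower X v s <= (rayleigh (n := n) (X^T *m Wmx X v *m X) u)%:E)%E.
  by apply: ereal_inf_lbound; exists u => //=; rewrite us lt0n l0norm_eq0 u0.
by rewrite -lee_fin fineK// fin_real// (lt_le_trans _ (ltW k0))//= (le_lt_trans ku)// ltry.
Qed.

Lemma mask_delta_compl (j : 'I_d) : v j 0 != 0 ->
  l1norm (Defs.mask (delta_mx j 0 : 'cV[R]_d) (compl S)) = 0 /\
  l1norm (Defs.mask (delta_mx j 0 : 'cV[R]_d) S) = 1.
Proof.
move=> vj; have cS : l1norm (Defs.mask (delta_mx j 0 : 'cV[R]_d) (compl S)) = 0.
  rewrite l1norm_mask big1// => k; rewrite inE !ffunE negbK mxE => /eqP vk.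
  by case: eqVneq => [kj|_]; rewrite ?normr0//; rewrite -kj vk eqxx in vj.
by split => //; have := l1norm_maskD (delta_mx j 0 : 'cV[R]_d) S; rewrite l1norm_delta cS addr0.
Qed.

(** A coordinate vector on the support of [v] lies in the cone. Finiteness is what lets [fine]
    preserve the positivity of [kappa1_cone]. *)
Lemma kappa1_cone_le : v != 0 -> (kappa1_cone X v <= (Xn ^+ 2 / 4)%:E)%E.
Proof.
move=> v0; have [j vj] : exists j, v j 0 != 0.
  apply/not_existsP => H; move/eqP: v0; apply; apply/colP => j; rewrite mxE.
  by apply/eqP/negbNE/negP; exact: H.
have h := rayleigh_W_delta_le j; rewrite -lee_fin in h.
apply: le_trans h; apply: ereal_inf_lbound.
exists (delta_mx j 0) => //=; split; first exact: delta_mx_neq0.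
by have [-> ->] := mask_delta_compl vj; rewrite mulr_ge0.
Qed.

Lemma kappa1_cone_quad u : (0 < n)%N -> (0 < kappa1_cone X v)%E ->
  l1norm (Defs.mask u (compl S)) <= 7 * l1norm (Defs.mask u S) ->
  fine (kappa1_cone X v) * (n%:R * l2norm u ^+ 2) <= quad (X^T *m Wmx X v *m X) u.
Proof.
move=> n0 k0 us; have [->|u0] := eqVneq u 0.
  have := quad_W 0; rewrite mulmx0 => ->.
  rewrite (_ : l2norm 0 = 0) ?expr0n ?mulr0/=; last first.
    by apply/eqP; rewrite eq_le l2norm_ge0 leNgt l2norm_gt0 eqxx.
  by rewrite sumr_ge0// => i _; rewrite mulr_ge0 ?gvar_ge0 ?sqr_ge0.
rewrite (quad_rayleigh _ u0 n0) ler_wpM2r ?mulr_ge0 ?l2norm_ge0//.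
have ku : (kappa1_cone X v <= (rayleigh (n := n) (X^T *m Wmx X v *m X) u)%:E)%E.
  by apply: ereal_inf_lbound; exists u.
by rewrite -lee_fin fineK// fin_real// (lt_le_trans _ (ltW k0))//= (le_lt_trans ku)// ltry.
Qed.

Lemma kappa1_upper_bounds s : (0 < s)%N -> (0 < d)%N -> (0 < n)%N ->
  (0 <= kappa1_upper X s <= (s%:R * Xn ^+ 2)%:E)%E.
Proof.
move=> s0 d0 n0; apply/andP; split.
  pose j := Ordinal d0.
  have h : ((rayleigh (n := n) (X^T *m X) (delta_mx j 0))%:E <= kappa1_upper X s)%E.
    by apply: ereal_sup_ubound; exists (delta_mx j 0) => //=; rewrite l0norm_delta.
  apply: le_trans h; rewrite /rayleigh.
  by rewrite lee_fin divr_ge0 ?quad_gram_ge0// !mulr_ge0 ?l2norm_ge0.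
apply: ge_ereal_sup => _ [u /= /andP[u0 us] <-].
rewrite lee_fin; rewrite lt0n l0norm_eq0 in u0.
have l20 : 0 < l2norm u by rewrite l2norm_gt0.
rewrite ler_pdivrMr ?mulr_gt0 ?ltr0n ?exprn_gt0//.
apply: le_trans (quad_gram_le _) _.
have hl : l1norm u ^+ 2 <= s%:R * l2norm u ^+ 2.
  apply: le_trans (_ : (Num.sqrt (l0norm u)%:R * l2norm u) ^+ 2 <= _).
    by rewrite ler_sqr ?nnegrE ?mulr_ge0 ?sqrtr_ge0 ?l1norm_ge0 ?l2norm_ge0// l1norm_le.
  by rewrite exprMn sqr_sqrtr// ler_wpM2r ?sqr_ge0// ler_nat.
rewrite (_ : s%:R * _ * _ = n%:R * (Xn ^+ 2 * (s%:R * l2norm u ^+ 2))); last by ring.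
by rewrite exprMn ler_wpM2l// ler_wpM2l// sqr_ge0.
Qed.

Lemma kappa1_upper_quad s u : (0 < s)%N -> (0 < d)%N -> (0 < n)%N ->
  (l0norm u <= s)%N ->
  quad (X^T *m X) u <= fine (kappa1_upper X s) * (n%:R * l2norm u ^+ 2).
Proof.
move=> s0 d0 n0 us; have /andP[k0 k1] := kappa1_upper_bounds s0 d0 n0.
have kf : kappa1_upper X s \is a fin_num.
  by rewrite ge0_fin_numE// (le_lt_trans k1)// ltry.
have [->|u0] := eqVneq u 0.
  rewrite quad_gram mulmx0 big1 ?mulr_ge0 ?l2norm_ge0 ?fine_ge0// => i _.
  by rewrite mxE expr0n.
rewrite (quad_rayleigh _ u0 n0) ler_wpM2r ?mulr_ge0 ?l2norm_ge0//.
rewrite -lee_fin fineK//; apply: ereal_sup_ubound; exists u => //=.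
by rewrite us lt0n l0norm_eq0 u0.
Qed.

End model.

(** * Real inequalities: the divergence against the l1 terms *)

Section inequalities.
Context {R : realType}.
Implicit Types (X r N l k x y t : R).

(** For large [y] the subtracted term has slope [b / (8 * X)], at least [17.5 * c] by the last
    hypothesis, so it beats [7 * c * y]. For small [y] it is quadratic and the maximum is of order
    [c ^+ 2 / b]. *)
Lemma cone_bound (b c X y : R) : 0 < b -> 0 <= c -> 0 <= X -> 0 <= y ->
  140 * (c * X) <= b ->
  7 * c * y - b * y ^+ 2 / (2 + 8 * X * y) <= 64 * c ^+ 2 / b.
Proof.
move=> b0 c0 X0 y0 cXb.
have Xy0 : 0 <= X * y by rewrite mulr_ge0.
have e0 : 0 < 2 + 8 * X * y by lra.
rewrite lerBlDr -[leLHS](mulfK (lt0r_neq0 e0)) -[X in _ <= X + _](mulfK (lt0r_neq0 e0)) -mulrDl.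
rewrite ler_pM2r ?invr_gt0//.
have c2b : 0 <= c ^+ 2 / b by rewrite divr_ge0 ?sqr_ge0 ?ltW.
set q := c ^+ 2 / b in c2b *.
rewrite (_ : 64 * c ^+ 2 / b = 64 * q); last by rewrite /q mulrA.
have bq : b * q = c ^+ 2 by rewrite /q mulrC divfK// gt_eqF.
(* With the denominator cleared, the left side contributes [14 * c * y] and [56 * c * X * y ^+ 2].
   By [h1], the second takes [4 / 10] of [b * y ^+ 2]; in [h2] the other [6 / 10] absorb the first
   by completing a square. *)
have h1 : 140 * (c * X) * y ^+ 2 <= b * y ^+ 2 by rewrite ler_wpM2r ?sqr_ge0.
have h2 : 14 * c * y <= b * y ^+ 2 * (6 / 10) + 128 * q.
  suff : 0 <= b * (b * y ^+ 2 * (6 / 10) + 128 * q - 14 * c * y).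
    by rewrite pmulr_rge0// subr_ge0.
  have -> : b * (b * y ^+ 2 * (6 / 10) + 128 * q - 14 * c * y) =
    6 / 10 * (b * y) ^+ 2 + 128 * (b * q) - 14 * c * (b * y) by ring.
  rewrite bq; set w := b * y.
  have -> : 6 / 10 * w ^+ 2 + 128 * c ^+ 2 - 14 * c * w =
    6 / 10 * (w - 35 / 3 * c) ^+ 2 + 139 / 3 * c ^+ 2 by field.
  by apply: addr_ge0; apply: mulr_ge0; rewrite ?sqr_ge0//; lra.
have h3 : 0 <= q * (X * y) by rewrite mulr_ge0.
lra.
Qed.

Lemma sum_ge_of_prod (a b c : R) : 0 <= a -> 0 <= b -> 0 <= c ->
  c ^+ 2 <= a * b -> c <= a + b.
Proof.
move=> a0 b0 c0 h; rewrite -ler_sqr ?nnegrE ?addr_ge0//.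
by apply: le_trans h _; have := mulr_ge0 a0 b0; rewrite sqrrD; nra.
Qed.

(* [x] is the l2 norm, [t] the l1 norm, [uS] and [uSc] the l1 norms of the parts
   on and off the support, [D] the divergence. *)
Lemma exponent_bound X r N l k x t (uS uSc D M : R) (s : nat) (sb : R) :
  0 < X -> 0 <= r -> 0 < N -> 1 <= l -> 0 < k -> 140 <= M ->
  s%:R <= sb -> 1 <= sb -> 0 <= uS -> 0 <= uSc -> t = uS + uSc ->
  uS <= Num.sqrt s%:R * x -> x <= t ->
  N * k * x ^+ 2 / (2 + X * t) <= D ->
  r ^+ 2 = N * l -> 140 * X ^+ 2 * s%:R * r <= N * k ->
  140 * X ^+ 2 * s%:R * l <= r * k -> 4 * k <= X ^+ 2 ->
  M * X / k * Num.sqrt (sb * l / N) < x ->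
  - (4 * X * r / 2) * t + 7 / 4 * (4 * X * r) * uS - 4 * X * r / 4 * uSc - D <=
  - (4 * X * r / 4) * t - M * (maxn s 1)%:R * l.
Proof.
move=> X0 r0 N0 l1 k0 M140 ssb sb1 uS0 uSc0 tE uSx xt hD r2 hNk hrk kX hx.
have l0 : 0 < l by exact: lt_le_trans l1.
have sb0 : 0 < sb by exact: lt_le_trans sb1.
have x0 : 0 < x.
  apply: le_lt_trans hx; rewrite mulr_ge0 ?sqrtr_ge0// divr_ge0 ?mulr_ge0// ?ltW//.
  exact: lt_le_trans M140.
have M0 : 0 < M by exact: lt_le_trans M140.
have Mx : M ^+ 2 * X ^+ 2 * (sb * l) <= N * k ^+ 2 * x ^+ 2.
  have h0 : 0 <= M * X / k * Num.sqrt (sb * l / N).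
    by rewrite mulr_ge0 ?sqrtr_ge0// divr_ge0 ?mulr_ge0// ?ltW.
  have : (M * X / k * Num.sqrt (sb * l / N)) ^+ 2 <= x ^+ 2.
    by rewrite ler_sqr ?nnegrE ?(ltW hx) ?h0 ?(ltW x0).
  rewrite exprMn sqr_sqrtr; last by rewrite divr_ge0 ?mulr_ge0// ?ltW//.
  have Nk0 : 0 < N * k ^+ 2 by rewrite mulr_gt0 ?exprn_gt0.
  move=> hx2; apply: le_trans (ler_wpM2l (ltW Nk0) hx2).
  by rewrite le_eqVlt; apply/orP; left; apply/eqP; field; rewrite !gt_eqF.
have t0 : 0 < t by exact: lt_le_trans xt.
have Xt0 : 0 < X * t by rewrite mulr_gt0.
have Nkx0 : 0 < N * k * x ^+ 2 by rewrite !mulr_gt0 ?exprn_gt0.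
have D0 : 0 <= D by apply: le_trans hD; rewrite divr_ge0 ?ltW// addr_gt0.
have Xr0 : 0 <= X * r by rewrite mulr_ge0// ltW.
have F2 : 4 * M ^+ 2 * (sb * l) <= N * k * x ^+ 2.
  rewrite -(ler_pM2l k0).
  apply: le_trans (_ : M ^+ 2 * X ^+ 2 * (sb * l) <= _).
    rewrite [leLHS](_ : _ = 4 * k * (M ^+ 2 * (sb * l))); last by ring.
    rewrite [leRHS](_ : _ = X ^+ 2 * (M ^+ 2 * (sb * l))); last by ring.
    by apply: ler_wpM2r => //; rewrite !mulr_ge0 ?sqr_ge0 ?ltW//.
  by apply: le_trans Mx _; rewrite le_eqVlt; apply/orP; left; apply/eqP; ring.
have rs : 560 * s%:R * l <= r.
  rewrite -(ler_pM2l k0).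
  apply: le_trans (_ : 140 * X ^+ 2 * s%:R * l <= _); last by rewrite [leRHS]mulrC.
  rewrite [leLHS](_ : _ = 4 * k * (140 * s%:R * l)); last by ring.
  rewrite [leRHS](_ : _ = X ^+ 2 * (140 * s%:R * l)); last by ring.
  by apply: ler_wpM2r => //; rewrite !mulr_ge0// ltW.
(* In the cone [D] must absorb [7 * X * r * uS]. Off it the l1 terms on and off the support balance,
   so that [D] and the leftover [X * r * t] only have to pay [M * maxn s 1 * l]. *)
have [cone|offcone] := leP uSc (7 * uS).
- have s1 : (1 <= s)%N.
    rewrite lt0n; apply/eqP => s0; move: uSx; rewrite s0 sqrtr0 mul0r => uS0'.
    lra.
  have m1 : maxn s 1 = s by apply/maxn_idPl.
  rewrite m1.
  have sR : 1 <= s%:R :> R by rewrite ler1n.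
  have s0 : 0 < s%:R :> R by exact: lt_le_trans sR.
  set q := Num.sqrt s%:R in uSx; have q0 : 0 < q by rewrite sqrtr_gt0.
  have q2 : q ^+ 2 = s%:R by rewrite sqr_sqrtr.
  pose y := q * x; have y0 : 0 < y by rewrite mulr_gt0.
  have {uSx} uSy : uS <= y by [].
  pose b := N * k / s%:R; have b0 : 0 < b by rewrite divr_gt0// mulr_gt0.
  have by2 : b * y ^+ 2 = N * k * x ^+ 2.
    by rewrite /b /y exprMn q2; field; rewrite gt_eqF.
  have hb : 140 * X ^+ 2 * r <= b.
    by rewrite ler_pdivlMr//; apply: le_trans hNk; rewrite mulrAC.
  have F1 : M * X * r <= b * y.
    have MXr0 : 0 <= M * X * r by rewrite !mulr_ge0// ltW.
    have by0 : 0 <= b * y by rewrite ltW// mulr_gt0.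
    rewrite -ler_sqr ?nnegrE ?MXr0 ?by0//.
    rewrite [leLHS](_ : _ = M ^+ 2 * X ^+ 2 * l * N); last first.
      by rewrite !exprMn r2; ring.
    rewrite [leRHS](_ : _ = N * (N * k ^+ 2 * x ^+ 2) / s%:R); last first.
      by rewrite /b /y !exprMn q2; field; rewrite gt_eqF.
    rewrite ler_pdivlMr//; apply: le_trans (ler_wpM2l (ltW N0) Mx).
    rewrite [leLHS](_ : _ = N * (M ^+ 2 * X ^+ 2 * l) * s%:R); last by ring.
    rewrite [leRHS](_ : _ = N * (M ^+ 2 * X ^+ 2 * l) * sb); last by ring.
    by apply: ler_wpM2l => //; rewrite !mulr_ge0 ?sqr_ge0// ltW.
  have hD' : b * y ^+ 2 / (2 + 8 * (X * y)) <= D.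
    apply: le_trans hD; rewrite by2 ler_pM2l//.
    rewrite lef_pV2 ?posrE ?addr_gt0 ?mulr_gt0// lerD2l.
    have := ler_wpM2l (ltW X0) (_ : t <= 8 * y); rewrite [X * (8 * y)]mulrCA; apply.
    by clear - tE uSy uS0 cone; rewrite tE; lra.
  have Xy0 : 0 < X * y by rewrite mulr_gt0.
  have sl0 : 0 < s%:R * l by rewrite mulr_gt0.
  suff : 7 * (X * r) * y + M * (s%:R * l) <= D.
    have : 7 * (X * r) * uS <= 7 * (X * r) * y by rewrite ler_wpM2l// mulr_ge0.
    have : 0 <= (X * r) * t by rewrite mulr_ge0// ltW.
    have : 0 <= (X * r) * uSc by rewrite mulr_ge0.
    clear; lra.
  apply: le_trans hD'; have by20 : 0 <= b * y ^+ 2 by rewrite mulr_ge0 ?sqr_ge0// ltW.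
  (* The denominator is at most 10 in the first case and at most [10 * (X * y)] in the second. In
     the quadratic regime the radius condition pays through [F1] and [F2]; in the linear one the
     sample size gives the slope ([hb]), and [F1] with [rs] gives the term in [l]. *)
  have [Xy1|Xy1] := leP (X * y) 1.
    apply: le_trans (_ : b * y ^+ 2 / 10 <= _); last first.
      apply: (ler_wpM2l by20).
      by rewrite lef_pV2 ?posrE; clear - Xy0 Xy1; lra.
    have h1 : 140 * (X * r) * y <= b * y * y.
      rewrite ler_pM2r//; apply: le_trans F1.
      by rewrite -mulrA ler_wpM2r.
    have h2 : 140 * (M * (s%:R * l)) <= b * y ^+ 2.
      rewrite by2; apply: le_trans F2; rewrite mulrA ler_pM//.
      - by rewrite mulr_ge0// ltW.
      - exact: ltW.
      - rewrite expr2; have := ler_wpM2r (ltW M0) M140.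
        have : 0 <= M * M by rewrite mulr_ge0// ltW.
        lra.
      - by rewrite ler_pM2r.
    rewrite expr2 mulrA in h2 by20 *.
    by clear - h1 h2 by20; lra.
  apply: le_trans (_ : b * y ^+ 2 / (10 * (X * y)) <= _); last first.
    apply: (ler_wpM2l by20).
    by rewrite lef_pV2 ?posrE; clear - Xy0 Xy1; lra.
  have -> : b * y ^+ 2 / (10 * (X * y)) = b * y / X / 10.
    by field; rewrite !gt_eqF.
  have h1 : 140 * (X * r) * y <= b * y / X.
    rewrite ler_pdivlMr//.
    rewrite [leLHS](_ : _ = 140 * X ^+ 2 * r * y); last by ring.
    by rewrite ler_pM2r.
  have h2 : M * r <= b * y / X by rewrite ler_pdivlMr// mulrAC.
  have h3 : M * (560 * s%:R * l) <= M * r by rewrite ler_pM2l.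
  have : 0 <= M * (s%:R * l) by rewrite mulr_ge0// ltW.
  by clear - h1 h2 h3; lra.
- suff h : M * (maxn s 1)%:R * l <= D + X * r * t.
    have : X * r * uSc >= X * r * (7 * uS) by rewrite ler_wpM2l// ltW.
    lra.
  (* For [s = 0] the leftover l1 term pays alone: [x <= t], and the radius condition with [1 <= sb]
     and [k <= X ^+ 2] gives [M * l <= X * r * x]. *)
  have [s0|s1] := posnP s.
    rewrite s0 maxnE/= mulr1.
    apply: le_trans (_ : X * r * t <= _); last by rewrite lerDr.
    apply: le_trans (_ : X * r * x <= _); last by rewrite ler_wpM2l.
    have Xrx0 : 0 <= X * r * x by rewrite mulr_ge0// ltW.
    have Ml0 : 0 <= M * l by rewrite mulr_ge0// ltW.
    rewrite -ler_sqr ?nnegrE ?Xrx0 ?Ml0//.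
    rewrite -(ler_pM2l (_ : 0 < k ^+ 2)) ?exprn_gt0//.
    rewrite [leRHS](_ : _ = X ^+ 2 * l * (N * k ^+ 2 * x ^+ 2)); last first.
      by rewrite !exprMn r2; ring.
    apply: le_trans (ler_wpM2l _ Mx); last by rewrite mulr_ge0 ?sqr_ge0// ltW.
    rewrite [leRHS](_ : _ = M ^+ 2 * l ^+ 2 * ((X ^+ 2) ^+ 2 * sb)); last by ring.
    rewrite exprMn mulrC; apply: ler_wpM2l; first by rewrite -exprMn sqr_ge0.
    apply: le_trans (_ : (X ^+ 2) ^+ 2 * 1 <= _); last by rewrite ler_wpM2l ?sqr_ge0.
    by rewrite mulr1 ler_sqr ?nnegrE ?sqr_ge0 ?(ltW k0)//; lra.
  have -> : maxn s 1 = s by apply/maxn_idPl.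
  have s0 : 0 < s%:R :> R by rewrite ltr0n.
  have sl0 : 0 < s%:R * l by rewrite mulr_gt0.
  have [Xt2|Xt2] := leP (X * t) 2.
    apply: le_trans (_ : D <= _); last by rewrite lerDl mulr_ge0// ltW.
    apply: le_trans hD; apply: le_trans (_ : N * k * x ^+ 2 / 4 <= _); last first.
      by rewrite ler_pM2l// lef_pV2 ?posrE; clear - Xt0 Xt2; lra.
    rewrite ler_pdivlMr//; apply: le_trans F2.
    rewrite -mulrA [leLHS]mulrAC [M * 4]mulrC -!mulrA ler_pM2l//.
    rewrite ler_pM2l// -[leLHS]mul1r ler_pM ?(ltW sl0)//; first lra.
    by rewrite ler_pM2r.
  (* Off the cone [t] may be arbitrarily large compared with [x], which weakens [D] but strengthens
     [X * r * t]. The lower bound on [D] is now inversely proportional to [t], so the product is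
     bounded below independently of [t]. *)
  apply: sum_ge_of_prod => //; first by rewrite mulr_ge0// ltW.
    by rewrite !mulr_ge0// ltW.
  apply: le_trans (_ : N * k * x ^+ 2 / (2 * (X * t)) * (X * r * t) <= _); last first.
    apply: ler_wpM2r; first by rewrite mulr_ge0// ltW.
    apply: le_trans hD.
    by rewrite ler_pM2l// lef_pV2 ?posrE; clear - Xt0 Xt2; lra.
  rewrite [leRHS](_ : _ = N * k * x ^+ 2 * r / 2); last by field; rewrite !gt_eqF.
  rewrite ler_pdivlMr//.
  apply: le_trans (ler_wpM2r r0 F2).
  apply: le_trans (_ : 4 * M ^+ 2 * (sb * l) * (560 * s%:R * l) <= _); last first.
    by apply: ler_wpM2l => //; rewrite !mulr_ge0 ?sqr_ge0// ltW.
  apply: le_trans (_ : 4 * M ^+ 2 * (s%:R * l) * (560 * s%:R * l) <= _); last first.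
    have sl560 : 0 <= 560 * s%:R * l by lra.
    apply: (ler_wpM2r sl560); apply: ler_wpM2l; first by rewrite mulr_ge0 ?sqr_ge0.
    by rewrite ler_pM2r.
  have : 0 <= (M * (s%:R * l)) ^+ 2 by exact: sqr_ge0.
  by rewrite -[M * s%:R * l]mulrA !exprMn; clear; lra.
Qed.

End inequalities.

(** * Integrals against the spike-and-slab base measures *)

Section integration.
Context {R : realType}.
Local Notation mR := (measurableTypeR R).
Local Notation leb := (@lebesgue_measure R).

Lemma continuous_expRNabs (a : R) : continuous (fun x : R => expR (- (a * `|x|))).
Proof.
move=> x; apply: continuous_comp; last exact: continuous_expR.
apply: continuousN; apply: continuousM; first exact: cst_continuous.
exact: norm_continuous.
Qed.

Lemma continuous_expRN (a : R) : continuous (fun x : R => expR (- (a * x))).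
Proof.
move=> x; apply: continuous_comp; last exact: continuous_expR.
by apply: continuousN; apply: continuousM; first exact: cst_continuous.
Qed.

Lemma is_derive_expRN (a x : R) :
  is_derive x 1 (fun x : R => - (expR (- (a * x)) / a)) (expR (- (a * x)) * a / a).
Proof.
have did := @is_derive_id R R^o x 1.
have d1 := @is_deriveZ R R^o R^o id (- a) x 1 1 did.
have d2 := @is_derive1_comp R (@expR R) _ x _ _ (is_derive_expR _) d1.
have d3 := @is_deriveZ R R^o R^o _ (- a^-1) x 1 _ d2.
have -> : (fun x : R => - (expR (- (a * x)) / a)) =
    (- a^-1 \*: (@expR R \o (- a \*: id))).
  by apply/funext => y /=; rewrite /GRing.scale/= !mulNr mulrC.
apply: is_derive_eq; rewrite /GRing.scale/= !mulNr mulr1.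
by rewrite [- a *: x]mulNr !mulrN opprK mulrC.
Qed.

Lemma integral_expRN_itv (a : R) : 0 < a ->
  (\int[leb]_(x in `[0%R, +oo[) (expR (- (a * x)))%:E = (a^-1)%:E)%E.
Proof.
move=> a0; have dF x := is_derive_expRN a x.
have cF : continuous (fun x : R => - (expR (- (a * x)) / a)).
  move=> x; apply/differentiable_continuous/derivable1_diffP.
  by have [] := dF x.
rewrite (@ge0_continuous_FTC2y _ _ (fun x => - (expR (- (a * x)) / a)) _ 0)//.
- by rewrite mulr0 oppr0 expR0 mul1r EFinN oppeK add0e.
- by apply: continuous_subspaceT; exact: continuous_expRN.
- rewrite -oppr0; apply: cvgN; rewrite -(mul0r a^-1); apply: cvgM; last exact: cvg_cst.
  apply: (@cvg_comp _ _ _ (fun x => a * x) (fun x => expR (- x)) _ (pinfty_nbhs R)); last exact: cvgr_expR.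
  by apply: gt0_cvgMry => //.
- by apply/cvg_at_right_filter; exact: cF.
- by move=> x _; rewrite derive1E; have [_ ->] := dF x; rewrite mulfK ?gt_eqF.
Qed.

Lemma cvg_subrNy (c : R) : x - c @[x --> -oo] --> -oo.
Proof.
apply/cvgrNyPle => A; near=> x; rewrite lerBlDr; near: x.
exact: nbhs_ninfty_le (num_real _).
Unshelve. all: end_near. Qed.

Lemma integral_laplace (a c : R) : 0 < a ->
  (\int[leb]_x (expR (- (a * `|x - c|)))%:E = (2 / a)%:E)%E.
Proof.
move=> a0; pose G (x : R) : R := expR (- (a * `|x|)).
have dF (x : R) : is_derive x 1 (fun x : R => x - c) 1.
  have := @is_deriveB R R^o R^o id (cst c) x 1 1 0 _ _.
  by rewrite subr0; exact.
have F'E : derive1 (fun x : R => x - c) = cst 1.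
  by apply/funext => x; rewrite derive1E; apply: derive_val; exact: dF.
transitivity (\int[leb]_x (G x)%:E)%E; last first.
  rewrite ge0_symfun_integralT//.
  - rewrite -set_itvcy.
    have -> : (\int[leb]_(x in `[0%R, +oo[) (G x)%:E = \int[leb]_(x in `[0%R, +oo[) (expR (- (a * x)))%:E)%E.
      by apply: eq_integral => x; rewrite inE/= in_itv/= andbT /G => x0; rewrite ger0_norm.
    by rewrite integral_expRN_itv.
  - by move=> x; exact: expR_ge0.
  - exact: continuous_expRNabs.
  - by move=> x; rewrite /G /= normrN.
rewrite [RHS](@increasing_ge0_integration_by_substitutionT _ (fun x : R => x - c))//.
- by apply: eq_integral => x _; rewrite F'E /GRing.mul_fun/= mulr1.
- by move=> x y xy; rewrite ltrD2r.
- by rewrite F'E => x; exact: cst_continuous.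
- by rewrite F'E; exact: is_cvg_cst.
- by rewrite F'E; exact: is_cvg_cst.
- exact: cvg_subrNy.
- exact: cvg_addrr.
- exact: continuous_expRNabs.
- by move=> x; exact: expR_ge0.
Qed.

Lemma measurable_mx_prod d (f : 'I_d -> R -> R) :
  (forall j, measurable_fun [set: mR] (f j)) ->
  measurable_fun [set: 'cV[R]_d] (fun v : 'cV[R]_d => (\prod_(j < d) f j (v j 0))%:E).
Proof.
move=> mf; apply/measurable_EFinP; apply: measurable_prod => j _.
apply: (@measurableT_comp _ _ _ _ mR mR (f j) setT (fun v : 'cV[R]_d => v j 0)).
  exact: mf.
exact: (@measurable_mx_entry _ R).
Qed.

Lemma integral_mu_prod d (delta : 'I_d -> bool) (f : 'I_d -> R -> R) :
  (forall j x, 0 <= f j x) -> (forall j, measurable_fun [set: mR] (f j)) ->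
  (\int[mu delta]_(v in [set: 'cV[R]_d]) (\prod_(j < d) f j (v j 0))%:E =
   \prod_(j < d) \int[nu (delta j)]_(x in [set: mR]) (f j x)%:E)%E.
Proof.
elim: d delta f => [|d IH] delta f f0 mf.
  under eq_integral do rewrite big_ord0.
  by rewrite big_ord0 /= integral_dirac// diracT mul1e.
rewrite big_ord_recl /=.
rewrite /cons_measure (ge0_integral_pushforward (measurable_mx_cons (d := d)))//; last 2 first.
  exact: measurable_mx_prod.
  by move=> v _; rewrite lee_fin prodr_ge0.
rewrite preimage_setT.
under eq_integral.
  move=> p _ /=.
  rewrite big_ord_recl mxE unlift_none /=.
  under eq_bigr do rewrite mxE liftK /=.
  over.
rewrite fubini_tonelli1//=; last 2 first.
- apply/measurable_EFinP; apply: measurable_funM.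
    apply: (@measurableT_comp _ _ _ _ mR mR (f ord0) setT fst); first exact: mf.
    exact: measurable_fst.
  pose g (v : 'cV[R]_d) : R := \prod_(i < d) f (lift ord0 i) (v i 0).
  apply: (@measurableT_comp _ _ _ _ 'cV[R]_d mR g setT snd); last exact: measurable_snd.
  by apply/measurable_EFinP; apply: (measurable_mx_prod (f := fun j => f (lift ord0 j))) => j.
- by move=> p; rewrite lee_fin mulr_ge0// prodr_ge0.
rewrite -(IH (fun j => delta (lift ord0 j)) (fun j => f (lift ord0 j)))//.
rewrite -ge0_integralZr//; last 3 first.
- by apply/measurable_EFinP; exact: mf.
- by move=> x _; rewrite lee_fin.
- by apply: integral_ge0 => v _; rewrite lee_fin prodr_ge0.
apply: eq_integral => x _; rewrite /fubini_F /=.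
under eq_integral do rewrite EFinM.
rewrite ge0_integralZl//.
- exact: (measurable_mx_prod (f := fun j => f (lift ord0 j))).
- by move=> v _; rewrite lee_fin prodr_ge0.
- by rewrite lee_fin.
Qed.

Lemma measurable_l1norm d (c : 'cV[R]_d) :
  measurable_fun [set: 'cV[R]_d] (fun v => l1norm (v - c) : mR).
Proof.
apply: measurable_sum => j.
under [F in measurable_fun _ F]eq_fun do rewrite !mxE.
apply: (@measurableT_comp _ _ _ _ mR mR Num.norm setT
  (fun v : 'cV[R]_d => v j 0 - c j 0)).
  exact: normr_measurable.
by apply: measurable_funB => //; exact: (@measurable_mx_entry _ R).
Qed.

Lemma measurable_expRN_l1norm d (c : 'cV[R]_d) (a : R) :
  measurable_fun [set: 'cV[R]_d] (fun v => expR (- (a * l1norm (v - c))) : mR).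
Proof.
apply: (@measurableT_comp _ _ _ _ mR mR expR setT
  (fun v : 'cV[R]_d => - (a * l1norm (v - c)))); first exact: measurable_expR.
apply: measurableT_comp => //; apply: measurable_funM => //.
exact: measurable_l1norm.
Qed.

(** The spike only evaluates the integrand at 0, hence the bound 1. A real witness for each
    coordinate lets the product over coordinates be compared in the reals. *)
Lemma integral_nu_laplace (b : bool) (a c : R) : 0 < a ->
  exists2 x : R, 0 <= x <= (if b then 2 / a else 1) &
    (\int[nu b]_(y in [set: mR]) (expR (- (a * `|y - c|)))%:E = x%:E)%E.
Proof.
move=> a0; case: b => /=.
  by exists (2 / a); [rewrite lexx divr_ge0// ltW|exact: integral_laplace].
exists (expR (- (a * `|0 - c|))).
  by rewrite expR_ge0/= -expR0 ler_expR oppr_le0 mulr_ge0// ltW.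
rewrite integral_dirac ?diracT ?mul1e//.
apply/measurable_EFinP.
apply: (@measurableT_comp _ _ _ _ mR mR expR setT
  (fun y : R => - (a * `|y - c|))); first exact: measurable_expR.
apply: measurableT_comp => //; apply: measurable_funM => //.
apply: (@measurableT_comp _ _ _ _ mR mR Num.norm setT (fun y : R => y - c)).
  exact: normr_measurable.
exact: measurable_funB.
Qed.

Lemma prodr_wt d (delta : {ffun 'I_d -> bool}) (x : R) :
  \prod_(j < d) (if delta j then x else 1) = x ^+ wt delta.
Proof.
rewrite -big_mkcond/= prodr_const /wt; congr (_ ^+ _).
by apply: eq_card => j; rewrite inE.
Qed.

Lemma integral_mu_laplace d (delta : {ffun 'I_d -> bool}) (c : 'cV[R]_d) (a : R) :
  0 < a ->
  (\int[mu delta]_(v in [set: 'cV[R]_d]) (expR (- (a * l1norm (v - c))))%:E <=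
   ((2 / a) ^+ wt delta)%:E)%E.
Proof.
move=> a0; pose f j (x : R) : R := expR (- (a * `|x - c j 0|)).
have -> : (\int[mu delta]_(v in [set: 'cV[R]_d]) (expR (- (a * l1norm (v - c))))%:E =
    \int[mu delta]_(v in [set: 'cV[R]_d]) (\prod_(j < d) f j (v j 0))%:E)%E.
  apply: eq_integral => v _; rewrite -expR_sum; congr (expR _)%:E.
  rewrite /l1norm mulr_sumr -sumrN; apply: eq_bigr => j _.
  by rewrite !mxE.
rewrite integral_mu_prod; last 2 first.
  by move=> j x; exact: expR_ge0.
  move=> j; apply: (@measurableT_comp _ _ _ _ mR mR expR setT
    (fun y : R => - (a * `|y - c j 0|))); first exact: measurable_expR.
  apply: measurableT_comp => //; apply: measurable_funM => //.
  apply: (@measurableT_comp _ _ _ _ mR mR Num.norm setT (fun y : R => y - c j 0)).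
    exact: normr_measurable.
  exact: measurable_funB.
have H j : {x : R | 0 <= x <= (if delta j then 2 / a else 1) /\
    (\int[nu (delta j)]_(y in [set: mR]) (f j y)%:E = x%:E)%E}.
  by apply/cid; have [x h1 h2] := integral_nu_laplace (delta j) (c j 0) a0; exists x.
rewrite (eq_bigr (fun j => (projT1 (H j))%:E)); last first.
  by move=> j _; case: (H j) => x /= [].
rewrite prodEFin lee_fin -prodr_wt; apply: ler_prod => j _.
by case: (H j) => x /= [].
Qed.

Lemma measurable_box d (A : 'I_d -> set mR) : (forall j, measurable (A j)) ->
  measurable [set v : 'cV[R]_d | forall j, A j (v j 0)].
Proof.
move=> mA; rewrite (_ : [set _ | _] = \bigcap_(j in [set: 'I_d])
  ((fun v : 'cV[R]_d => v j 0) @^-1` A j)); last first.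
  by apply/seteqP; split => v /= H j; [move=> _|]; exact: H.
apply: fin_bigcap_measurable => // j _.
by have := @measurable_mx_entry _ R d 1 j 0 measurableT _ (mA j); rewrite setTI.
Qed.

(** More nonzero entries than [wt delta] force one outside [delta], where the base measure is a
    Dirac mass at 0. *)
Lemma mu_l0norm_gt d (delta : {ffun 'I_d -> bool}) :
  (mu delta).-negligible [set v : 'cV[R]_d | (wt delta < l0norm v)%N].
Proof.
(* Indexed by the natural numbers to form a countable union; the sets with [k >= d] or with [k] in
   [delta] are empty. *)
pose F (k : nat) := [set v : 'cV[R]_d | exists j : 'I_d, [/\ j = k :> nat, ~~ delta j & v j 0 != 0]].
apply: (negligibleS (A := \bigcup_k F k)).
  move=> v /= vd; apply: contrapT => nF; move: vd; rewrite ltnNge => /negP; apply.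
  apply: subset_leq_card; apply/fintype.subsetP => j; rewrite !inE.
  apply: contraR => dj; apply/negP => vj; apply: nF; exists (nat_of_ord j) => //.
  by exists j; split => //; apply/negP.
apply: negligible_bigcup => k.
have [kd|kd] := ltnP k d; last first.
  rewrite (_ : F k = set0); first exact: negligible_set0.
  by apply/seteqP; split => // v [j [jk _ _]]; move: (ltn_ord j); rewrite jk ltnNge kd.
have [dk|dk] := boolP (delta (Ordinal kd)).
  rewrite (_ : F k = set0); first exact: negligible_set0.
  apply/seteqP; split => // v [j [jk dj _]].
  by move/negP: dj; apply; rewrite (_ : j = Ordinal kd)//; exact: val_inj.
pose A (j : 'I_d) : set mR := if j == k :> nat then ~` [set 0] else setT.
have mA j : measurable (A j).
  by rewrite /A; case: ifP => // _; apply: measurableC; exact: measurable_set1.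
have FE : F k `<=` [set v | forall j, A j (v j 0)].
  move=> v [j [jk dj vj]] i /=; rewrite /A; case: ifP => // /eqP ik.
  by rewrite (_ : i = j); [exact/eqP|apply: val_inj; rewrite /= jk ik].
apply: (negligibleS FE); apply/(negligibleP _ (measurable_box mA)).
have nu0 : nu (delta (Ordinal kd)) (A (Ordinal kd)) = 0%E.
  by rewrite (negbTE dk) /A/= eqxx diracE memNset//=; apply.
by apply: etrans (mu_box delta mA) _; rewrite (bigD1 (Ordinal kd))//= nu0 mul0e.
Qed.

End integration.

(** * Upper and lower bounds on unnormalized posterior masses *)

Section posterior_mass.
Context {R : realType} {n d : nat}.
Variables (X : 'M[R]_(n, d)) (pi_ : {ffun 'I_d -> bool} -> R) (rho : R).
Variable (z : 'I_n -> bool).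
Hypotheses (pi0 : forall delta, 0 <= pi_ delta) (rho0 : 0 < rho).
Local Notation mR := (measurableTypeR R).
Implicit Types (v : 'cV[R]_d) (B : set 'cV[R]_d) (delta : {ffun 'I_d -> bool}).

Let integrand v : R := expR (loglik X z v) * expR (- (rho * l1norm v)).

Lemma measurable_mulmx (i : 'I_n) :
  measurable_fun [set: 'cV[R]_d] (fun v => (X *m v) i 0 : mR).
Proof.
under [F in measurable_fun _ F]eq_fun do rewrite mxE.
apply: measurable_sum => j; apply: measurable_funM => //.
exact: (@measurable_mx_entry _ R).
Qed.

Lemma measurable_loglik : measurable_fun [set: 'cV[R]_d] (fun v => loglik X z v : mR).
Proof.
apply: measurable_sum => i; apply: measurable_funB.
  by apply: measurable_funM => //; exact: measurable_mulmx.
apply: (@measurableT_comp _ _ _ _ mR mR (glogit : R -> R) setT (fun v => (X *m v) i 0)).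
  apply: continuous_measurable_fun => x.
  apply/differentiable_continuous/derivable1_diffP.
  by have [] := is_derive_glogit x.
exact: measurable_mulmx.
Qed.

Lemma measurable_integrand : measurable_fun [set: 'cV[R]_d] (integrand : _ -> mR).
Proof.
apply: measurable_funM.
  apply: (@measurableT_comp _ _ _ _ mR mR expR setT (fun v => loglik X z v)).
    exact: measurable_expR.
  exact: measurable_loglik.
have := @measurable_expRN_l1norm R d 0 rho.
by under [F in measurable_fun _ F -> _]eq_fun do rewrite subr0.
Qed.

Lemma integrand_ge0 v : 0 <= integrand v.
Proof. by rewrite mulr_ge0// expR_ge0. Qed.

Lemma post_mass_ge0 B : (0 <= post_mass X pi_ rho z B)%E.
Proof.
apply: sume_ge0 => delta _; apply: mule_ge0.
  by rewrite lee_fin mulr_ge0// exprn_ge0// divr_ge0// ltW.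
by apply: integral_ge0 => v _; rewrite lee_fin integrand_ge0.
Qed.

(** Models outside [P] do not charge [B]. In the others the Laplace integral [(2 / a) ^+ wt delta]
    meets the prior factor [(rho / 2) ^+ wt delta], leaving a sum over models alone. *)
Lemma post_mass_le B v (a K : R) (P : pred {ffun 'I_d -> bool}) :
  measurable B -> 0 < a -> 0 <= K ->
  (forall delta, ~~ P delta -> B `<=` [set u | (wt delta < l0norm u)%N]) ->
  (forall u, B u -> integrand u <= K * expR (- (a * l1norm (u - v)))) ->
  (post_mass X pi_ rho z B <=
    (K * \sum_(delta | P delta) pi_ delta * (rho / a) ^+ wt delta)%:E)%E.
Proof.
move=> mB a0 K0 PB BK.
have mI : measurable_fun B (fun u => (integrand u)%:E).
  by apply/measurable_EFinP; apply: measurable_funTS; exact: measurable_integrand.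
have mE : measurable_fun [set: 'cV[R]_d] (fun u => (expR (- (a * l1norm (u - v))))%:E).
  by apply/measurable_EFinP; exact: measurable_expRN_l1norm.
rewrite /post_mass (bigID P)/= [X in (_ + X <= _)%E]big1 ?adde0; last first.
  move=> delta nP; rewrite null_set_integral ?mule0//.
  by apply/(negligibleP _ mB); apply: negligibleS (mu_l0norm_gt delta); exact: PB.
rewrite mulr_sumr -sumEFin; apply: lee_sum => delta Pd.
apply: le_trans (_ : ((pi_ delta * (rho / 2) ^+ wt delta)%:E *
    (K * (2 / a) ^+ wt delta)%:E <= _)%E); last first.
  rewrite -EFinM lee_fin mulrCA ler_wpM2l// -mulrA ler_wpM2l//.
  by rewrite -exprMn [rho / 2 * _]mulrA divfK.
apply: lee_wpmul2l.
  by rewrite lee_fin mulr_ge0// exprn_ge0// divr_ge0// ltW.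
apply: le_trans (_ : \int[mu delta]_(u in B) (K%:E * (expR (- (a * l1norm (u - v))))%:E) <= _)%E.
  apply: ge0_le_integral => //.
  by apply: emeasurable_funM => //; exact: measurable_funS mE.
rewrite ge0_integralZl//; last exact: measurable_funS mE.
rewrite EFinM; apply: lee_wpmul2l; first by rewrite lee_fin.
apply: le_trans (integral_mu_laplace delta v a0).
exact: ge0_subset_integral.
Qed.

Lemma post_mass_fin B : measurable B -> post_mass X pi_ rho z B \is a fin_num.
Proof.
move=> mB; rewrite ge0_fin_numE ?post_mass_ge0//.
apply: le_lt_trans (@post_mass_le B 0 rho 1 xpredT mB rho0 ler01 _ _) _ => //.
  move=> u _; rewrite mul1r subr0 -[leRHS]mul1r ler_wpM2r ?expR_ge0//.
  by rewrite -expR0 ler_expR loglik_le0.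
exact: ltry.
Qed.

(** Keeps a single model and, within it, the box of half-width [r] around [v], of volume
    [(2 * r) ^+ wt delta]. *)
Lemma post_mass_ge v (r K : R) (delta : {ffun 'I_d -> bool}) :
  0 <= r -> 0 <= K ->
  (forall u : 'cV[R]_d, (forall j, delta j -> `|u j 0| <= r) -> (forall j, ~~ delta j -> u j 0 = 0) ->
     K <= integrand (v + u)) ->
  (forall j, ~~ delta j -> v j 0 = 0) ->
  ((pi_ delta * (rho * r) ^+ wt delta * K)%:E <= post_mass X pi_ rho z setT)%E.
Proof.
move=> r0 K0 HK v0.
pose A (j : 'I_d) : set mR :=
  if delta j then `[v j 0 - r, v j 0 + r]%classic else [set 0].
have mA j : measurable (A j).
  by rewrite /A; case: ifP => _ //; exact: measurable_set1.
have mB := measurable_box mA; set B := [set u | _] in mB.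
rewrite /post_mass (bigD1 delta)//=.
apply: le_trans (leeDl _ _); last first.
  apply: sume_ge0 => e _; apply: mule_ge0.
    by rewrite lee_fin mulr_ge0// exprn_ge0// divr_ge0// ltW.
  by apply: integral_ge0 => u _; rewrite lee_fin integrand_ge0.
have mI : measurable_fun [set: 'cV[R]_d] (fun u => (integrand u)%:E).
  by apply/measurable_EFinP; exact: measurable_integrand.
have h : ((K * (2 * r) ^+ wt delta)%:E <= \int[mu delta]_(u in setT) (integrand u)%:E)%E.
  apply: le_trans (_ : \int[mu delta]_(u in B) (integrand u)%:E <= _)%E; last first.
    apply: ge0_subset_integral => //.
    by move=> u _; rewrite lee_fin integrand_ge0.
  apply: le_trans (_ : \int[mu delta]_(u in B) (cst K%:E u) <= _)%E; last first.
    apply: ge0_le_integral => //.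
    - exact: measurable_funS mI.
    - move=> u Bu; rewrite lee_fin -[u](subrK v) addrC; apply: HK => j dj.
        have := Bu j; rewrite /A dj/= in_itv/= !mxE => /andP[h1 h2].
        by rewrite ler_norml; apply/andP; split; lra.
      by have := Bu j; rewrite /A (negbTE dj)/= !mxE => ->; rewrite v0// subr0.
  rewrite integral_cst// EFinM; apply: lee_wpmul2l; first by rewrite lee_fin.
  apply: (@le_trans _ _ (\prod_(j < d) nu (delta j) (A j))%E); last first.
    by rewrite le_eqVlt; apply/orP; left; apply/eqP/esym; exact: mu_box.
  rewrite (eq_bigr (fun j => (if delta j then 2 * r else 1)%:E)).
    by rewrite prodEFin prodr_wt.
  move=> j _; rewrite /A; case: (delta j) => /=; last by rewrite diracE mem_set.
  rewrite lebesgue_measure_itv/= lte_fin; case: ifPn => h.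
    by rewrite -EFinD; congr _%:E; ring.
  by congr _%:E; lra.
apply: le_trans (lee_wpmul2l _ h); last first.
  by rewrite lee_fin mulr_ge0// exprn_ge0// divr_ge0// ltW.
rewrite -EFinM lee_fin le_eqVlt; apply/orP; left; apply/eqP.
rewrite (_ : rho * r = rho / 2 * (2 * r)) ?exprMn; first by ring.
by field.
Qed.

Lemma posterior_ge0 B : 0 <= posterior X pi_ rho z B.
Proof. by rewrite divr_ge0// fine_ge0// post_mass_ge0. Qed.

Lemma posterior_le B (num den : R) : measurable B -> 0 < den ->
  (post_mass X pi_ rho z B <= num%:E)%E ->
  (den%:E <= post_mass X pi_ rho z setT)%E ->
  posterior X pi_ rho z B <= num / den.
Proof.
move=> mB den0 hnum hden.
have f1 : fine (post_mass X pi_ rho z B) <= num.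
  by rewrite -lee_fin fineK// post_mass_fin.
have f2 : den <= fine (post_mass X pi_ rho z setT).
  by rewrite -lee_fin fineK// post_mass_fin.
apply: ler_pM => //.
- by rewrite fine_ge0// post_mass_ge0.
- by rewrite invr_ge0 fine_ge0// post_mass_ge0.
- by rewrite lef_pV2// posrE// (lt_le_trans den0).
Qed.

Lemma post_mass_subset B C : measurable B -> measurable C -> B `<=` C ->
  (post_mass X pi_ rho z B <= post_mass X pi_ rho z C)%E.
Proof.
move=> mB mC BC; apply: lee_sum => delta _; apply: lee_wpmul2l.
  by rewrite lee_fin mulr_ge0// exprn_ge0// divr_ge0// ltW.
apply: ge0_subset_integral => //.
by apply/measurable_EFinP; apply: measurable_funTS; exact: measurable_integrand.
Qed.

Lemma posterior_le1 B : measurable B -> posterior X pi_ rho z B <= 1.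
Proof.
move=> mB; have h := post_mass_subset mB measurableT (@subsetT _ B).
have h1 : fine (post_mass X pi_ rho z B) <= fine (post_mass X pi_ rho z setT).
  by rewrite fine_le// post_mass_fin.
rewrite /posterior; set p := fine _ in h1 *; set q := fine _ in h1 *.
have p0 : 0 <= p by rewrite fine_ge0// post_mass_ge0.
(* If the total mass vanishes, the quotient is 0 by the convention on inverses. *)
have [q0|q0] := eqVneq q 0; first by rewrite q0 invr0 mulr0.
have q1 : 0 < q by rewrite lt0r q0 (le_trans p0 h1).
by rewrite ler_pdivrMr// mul1r.
Qed.

Lemma posteriorU_le B C D : measurable B -> measurable C -> measurable D ->
  B `<=` C `|` D ->
  posterior X pi_ rho z B <= posterior X pi_ rho z C + posterior X pi_ rho z D.
Proof.
move=> mB mC mD BCD; rewrite -mulrDl.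
apply: ler_wpM2r; first by rewrite invr_ge0 fine_ge0// post_mass_ge0.
rewrite -fineD ?post_mass_fin// fine_le ?post_mass_fin// ?fin_numD ?post_mass_fin//.
rewrite /post_mass -big_split/=; apply: lee_sum => delta _.
rewrite -ge0_muleDr; [|by apply: integral_ge0 => v _; rewrite lee_fin integrand_ge0..].
apply: lee_wpmul2l.
  by rewrite lee_fin mulr_ge0// exprn_ge0// divr_ge0// ltW.
have mI : measurable_fun [set: 'cV[R]_d] (fun u => (integrand u)%:E).
  by apply/measurable_EFinP; exact: measurable_integrand.
apply: le_trans (_ : \int[mu delta]_(u in C `|` D) (integrand u)%:E <= _)%E.
  apply: ge0_subset_integral => //; first exact: measurableU.
  exact: measurable_funTS.
rewrite (_ : C `|` D = C `|` (D `\` C)); last by rewrite setUDr setDv setD0.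
have mDC : measurable (D `\` C) by exact: measurableD.
rewrite ge0_integral_setU//; last 3 first.
- exact: measurable_funTS.
- by move=> u _; rewrite lee_fin integrand_ge0.
- by apply/disj_setPS => u [? []].
apply: leeD => //; apply: ge0_subset_integral => //.
  exact: measurable_funTS.
by move=> u _; rewrite lee_fin integrand_ge0.
Qed.

End posterior_mass.

(** * The prior on the model size *)

Section prior.
Context {R : realType} {d : nat}.
Variables (c1 c2 c3 c4 : R) (g : nat -> R) (pi_ : {ffun 'I_d -> bool} -> R).
Hypotheses (c10 : 0 < c1) (c20 : 0 < c2) (c40 : 0 < c4) (d0 : (0 < d)%N).
Hypotheses (g0 : forall s, (s <= d)%N -> 0 <= g s)
  (g1 : \sum_(0 <= s < d.+1) g s = 1)
  (hg : forall s, (1 <= s <= d)%N ->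
    c1 / d%:R `^ c3 * g s.-1 <= g s <= c2 / d%:R `^ c4 * g s.-1)
  (hpi : forall delta, pi_ delta = g (wt delta) / 'C(d, wt delta)%:R)
  (hd : 8 * c2 <= d%:R `^ (c4 / 2)).

Let dpos : 0 < d%:R :> R. Proof. by rewrite ltr0n. Qed.

Let pd (x : R) : 0 < d%:R `^ x. Proof. exact: powR_gt0. Qed.

Lemma prior_le_expn s t : (s <= t <= d)%N ->
  g t <= (c2 / d%:R `^ c4) ^+ (t - s) * g s.
Proof.
move=> /andP[st]; rewrite -{1 2}(subnK st); elim: (t - s)%N => [|k IH] kd.
  by rewrite add0n expr0 mul1r.
have /andP[_] := hg (s := (k.+1 + s)%N) (introT andP (conj (ltn0Sn _) kd)).
move=> hk; apply: le_trans hk _; rewrite addSn /= exprS -[leRHS]mulrA ler_wpM2l//.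
  by rewrite divr_ge0// ltW.
by apply: IH; apply: leq_trans kd; rewrite addSn.
Qed.

Lemma prior0_le s : (s <= d)%N -> g 0%N <= (d%:R `^ c3 / c1) ^+ s * g s.
Proof.
elim: s => [|s IH] sd; first by rewrite expr0 mul1r.
apply: le_trans (IH (ltnW sd)) _; rewrite exprSr -[leRHS]mulrA ler_wpM2l//.
  by rewrite exprn_ge0// divr_ge0// ltW.
have /andP[+ _] := hg (s := s.+1) sd.
rewrite /= mulrAC ler_pdivrMr// => h.
by rewrite mulrAC ler_pdivlMr// mulrC [leRHS]mulrC.
Qed.

(** If [g 0] vanished, the upper ratio bound would annihilate every weight, against total mass 1;
    the lower ratio bound then propagates positivity. *)
Lemma prior_gt0 s : (s <= d)%N -> 0 < g s.
Proof.
move=> sd; have gs : 0 < g 0%N.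
  rewrite lt0r g0// andbT; apply/eqP => g00.
  suff : \sum_(0 <= s < d.+1) g s = 0 by rewrite g1 => /eqP; rewrite oner_eq0.
  rewrite big_nat big1// => k /andP[_ kd]; apply/eqP; rewrite eq_le g0// andbT.
  by apply: le_trans (@prior_le_expn 0 k kd) _; rewrite g00 mulr0.
rewrite lt0r g0// andbT; apply/eqP => gs0.
by have := prior0_le sd; rewrite gs0 mulr0 leNgt gs.
Qed.

Lemma wt_le (delta : {ffun 'I_d -> bool}) : (wt delta <= d)%N.
Proof. by rewrite -[leqRHS]card_ord; exact: max_card. Qed.

Lemma prior_ge0 delta : 0 <= pi_ delta.
Proof. by rewrite hpi divr_ge0// g0// wt_le. Qed.

Lemma card_wt (s : nat) : #|[set delta : {ffun 'I_d -> bool} | wt delta == s]%SET| = 'C(d, s).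
Proof.
rewrite -[d in RHS]card_ord -card_draws.
pose h (A : {set 'I_d}) : {ffun 'I_d -> bool} := [ffun j => j \in A].
have hh A : [set j | h A j]%SET = A by apply/setP => j; rewrite inE ffunE.
have hi : injective h by move=> A B /(congr1 (fun f : {ffun 'I_d -> bool} => [set j | f j]%SET)); rewrite !hh.
rewrite -(card_imset _ hi); apply: eq_card => f; rewrite !inE.
apply/eqP/imsetP => [fs|[A]].
  exists [set j | f j]%SET; first by rewrite inE -fs.
  by apply/ffunP => j; rewrite ffunE inE.
by rewrite inE => /eqP As ->; rewrite /wt hh.
Qed.

(** Given its size a model is uniform, so the number of models of each size cancels the binomial
    coefficient. *)
Lemma sum_prior (P : pred nat) (K : R) :
  \sum_(delta | P (wt delta)) pi_ delta * K ^+ wt delta =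
  \sum_(s < d.+1 | P s) g s * K ^+ s.
Proof.
have wtd (delta : {ffun 'I_d -> bool}) : (wt delta < d.+1)%N by rewrite ltnS wt_le.
rewrite (partition_big (fun delta => Ordinal (wtd delta)) (fun s : 'I_d.+1 => P s))//=.
apply: eq_bigr => s Ps.
rewrite (eq_bigl (fun delta => delta \in [set delta : {ffun 'I_d -> bool} | wt delta == s]%SET)); last first.
  move=> delta; rewrite inE -val_eqE /=; case: eqVneq => [->|]; rewrite ?Ps//.
  by rewrite andbF.
rewrite (eq_bigr (fun=> g s / 'C(d, s)%:R * K ^+ s)); last first.
  by move=> delta; rewrite inE => /eqP wts; rewrite hpi wts.
rewrite sumr_const card_wt -[LHS]mulr_natl mulrA; congr (_ * _).
by rewrite mulrC divfK// pnatr_eq0 -lt0n bin_gt0 -ltnS.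
Qed.

Lemma sum_half_le (m N : nat) : \sum_(s < N | (m <= s)%N) (2^-1 : R) ^+ (s - m) <= 2.
Proof.
(* Strengthened to make the induction go through. With truncated subtraction the right-hand side is
   0 as long as the sum is empty. *)
suff h : \sum_(s < N | (m <= s)%N) (2^-1 : R) ^+ (s - m) <= 2 - 2 * 2^-1 ^+ (N - m).
  by apply: le_trans h _; rewrite gerBl mulr_ge0// exprn_ge0// invr_ge0.
elim: N => [|N IH]; first by rewrite big_ord0 sub0n expr0; lra.
rewrite big_mkcond big_ord_recr/= -big_mkcond/=.
have [mN|Nm] := leqP m N; last first.
  by rewrite addr0 (eqP (_ : N.+1 - m == 0)%N)// ?subn_eq0// in IH *;
    rewrite (eqP (_ : N - m == 0)%N) ?subn_eq0 1?ltnW// in IH.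
rewrite subSn// exprS; move: IH; set x := _ ^+ _; lra.
Qed.

(** For [K <= 4], [hd] bounds the ratio [c2 / d^c4 * K] of consecutive terms by
    [1 / 2 * d^(- c4 / 2)]. The halves sum to at most 2, and the powers of [d] give the exponential,
    since [s - m >= zt - m] in the tail. *)
Lemma prior_tail_le (m : nat) (zt K : R) : (m <= d)%N -> m%:R <= zt -> 0 <= K <= 4 ->
  \sum_(s < d.+1 | zt <= s%:R) g s * K ^+ s <=
  2 * g m * K ^+ m * expR (- (ln d%:R * (c4 / 2 * (zt - m%:R)))).
Proof.
move=> md mz /andP[K0 K4].
set T := expR _.
have T0 : 0 <= T by exact: expR_ge0.
have gK0 : 0 <= g m * K ^+ m by rewrite mulr_ge0 ?g0// exprn_ge0.
apply: le_trans (_ : \sum_(s < d.+1 | (m <= s)%N) (2^-1 : R) ^+ (s - m) * (g m * K ^+ m * T) <= _); last first.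
  rewrite -mulr_suml (_ : 2 * g m * K ^+ m * T = 2 * (g m * K ^+ m * T)); last by ring.
  by apply: ler_wpM2r; [exact: mulr_ge0|exact: sum_half_le].
rewrite big_mkcond [leRHS]big_mkcond/=; apply: ler_sum => s _.
have [zs|_] := leP zt s%:R; last first.
  case: ifP => // _; apply: mulr_ge0; last exact: mulr_ge0.
  by rewrite exprn_ge0// invr_ge0.
have ms : (m <= s)%N by rewrite -(ler_nat R) (le_trans mz).
have sd : (s <= d)%N by rewrite -ltnS.
rewrite ms.
have h1 := @prior_le_expn m s (introT andP (conj ms sd)).
apply: le_trans (_ : ((c2 / d%:R `^ c4) ^+ (s - m) * g m) * K ^+ s <= _).
  by rewrite ler_wpM2r// exprn_ge0.
rewrite -{2}(subnK ms) exprD.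
rewrite (_ : _ * (_ * _) = ((c2 / d%:R `^ c4) ^+ (s - m) * K ^+ (s - m)) * (g m * K ^+ m)); last by ring.
rewrite [leRHS](_ : _ = (2^-1 ^+ (s - m) * T) * (g m * K ^+ m)); last by ring.
apply: ler_wpM2r => //; rewrite -exprMn.
have h2 : c2 / d%:R `^ c4 * K <= 2^-1 * expR (- (ln d%:R * (c4 / 2))).
  have := hd; set p := d%:R `^ (c4 / 2) => hdp; have p0 : 0 < p by exact: pd.
  have -> : d%:R `^ c4 = p * p.
    rewrite /p -powRD; last by rewrite (gt_eqF dpos) implybT.
    by congr (_ `^ _); field.
  have -> : expR (- (ln d%:R * (c4 / 2))) = p^-1.
    by rewrite expRN; congr _^-1; rewrite /p /powR (gt_eqF dpos) mulrC.
  rewrite -subr_ge0 (_ : _ - _ = (p - 2 * c2 * K) / (2 * (p * p))); last first.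
    by field; rewrite !gt_eqF.
  rewrite divr_ge0 ?mulr_ge0// ?(ltW p0)// subr_ge0; apply: le_trans hd.
  have := ler_wpM2l (ltW c20) K4; lra.
apply: le_trans (lerXn2r _ _ _ h2) _; rewrite ?nnegrE.
- by rewrite mulr_ge0// divr_ge0// ltW.
- by rewrite mulr_ge0 ?expR_ge0.
rewrite exprMn ler_wpM2l ?exprn_ge0// -expRM_natl ler_expR mulrN lerN2.
rewrite [leRHS](_ : _ = ln d%:R * (c4 / 2 * (s - m)%:R)); last by ring.
apply: ler_wpM2l; first by rewrite ln_ge0// ler1n.
apply: ler_wpM2l; first by rewrite divr_ge0// ltW.
by rewrite natrB// lerD2r.
Qed.

End prior.

Lemma bin_le_expn (m k : nat) : ('C(m, k) <= m ^ k)%N.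
Proof.
apply: (@leq_trans (m ^_ k)); first by rewrite -bin_ffact leq_pmulr// fact_gt0.
elim: k => // k IH; rewrite ffactnSr expnSr.
by apply: leq_mul => //; exact: leq_subr.
Qed.

(** * Posterior bounds for an observation with a small score *)

Section deterministic.
Context {R : realType} {n d : nat}.
Variables (X : 'M[R]_(n, d)) (v : 'cV[R]_d) (z : 'I_n -> bool).
Variables (c1 c2 c3 c4 : R) (g : nat -> R) (pi_ : {ffun 'I_d -> bool} -> R).
Hypotheses (c10 : 0 < c1) (c20 : 0 < c2) (c40 : 0 < c4).
Hypotheses (g0 : forall s, (s <= d)%N -> 0 <= g s)
  (g1 : \sum_(0 <= s < d.+1) g s = 1)
  (hg : forall s, (1 <= s <= d)%N ->
    c1 / d%:R `^ c3 * g s.-1 <= g s <= c2 / d%:R `^ c4 * g s.-1)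
  (hpi : forall delta, pi_ delta = g (wt delta) / 'C(d, wt delta)%:R)
  (hd : 8 * c2 <= d%:R `^ (c4 / 2)).
Hypotheses (n0 : (0 < n)%N) (d1 : (1 < d)%N) (X0 : 0 < mx_norm X).

Local Notation Xn := (mx_norm X).
Local Notation l := (@ln R d%:R).
Local Notation rho := (4 * Xn * Num.sqrt (n%:R * l)).
Local Notation s := (l0norm v).
Local Notation L0 := (loglik X z v - rho * l1norm v).

Hypotheses (l1 : 1 <= l) (hsc : forall j, `|score X v z j| <= rho / 4).

Let d0 : (0 < d)%N. Proof. exact: ltnW. Qed.

Let dpos : 0 < d%:R :> R. Proof. by rewrite ltr0n. Qed.

Let l0 : 0 < l. Proof. exact: lt_le_trans l1. Qed.

Let r0 : 0 < Num.sqrt (n%:R * l). Proof. by rewrite sqrtr_gt0 mulr_gt0 ?ltr0n. Qed.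

Let rho0 : 0 < rho. Proof. by rewrite !mulr_gt0. Qed.

Let sd : (s <= d)%N. Proof. by rewrite -wt_supp wt_le. Qed.

Let expRl : expR l = d%:R. Proof. by rewrite lnK// posrE. Qed.

Let pi0 := prior_ge0 g0 hpi.

Lemma sum_box (u : 'cV[R]_d) (delta : {ffun 'I_d -> bool}) (f : R -> R) (c : R) :
  f 0 = 0 -> (forall j, delta j -> f (u j 0) <= c) -> (forall j, ~~ delta j -> u j 0 = 0) ->
  \sum_(j < d) f (u j 0) <= (wt delta)%:R * c.
Proof.
move=> f0 fc u0; rewrite (bigID (fun j => delta j))/= [X in _ + X]big1 ?addr0; last first.
  by move=> j dj; rewrite u0.
apply: le_trans (ler_sum _ fc) _; rewrite sumr_const mulr_natl /wt.
by rewrite (_ : #|_| = #|[set j | delta j]%SET|)//; apply: eq_card => j; rewrite inE.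
Qed.

(** The radius [rr] makes [rho * l1norm u] and the Gram form both at most [s] on the box, the latter
    because [4 * q <= (1 + q) ^+ 2]; the loss is [5 / 4 + 1 / 8 = 11 / 8] per coordinate. The number
    of models of size [s] costs at most [d ^+ s], hence [l], and the volume costs [(1 + q) ^+ s],
    hence [w]. *)
Lemma denominator_ge (q w : R) : 0 <= q -> 1 + q <= expR w ->
  (forall u : 'cV[R]_d, (l0norm u <= s)%N ->
    quad (X^T *m X) u <= 64 * Xn ^+ 2 * l * q * (n%:R * l2norm u ^+ 2)) ->
  ((g s * expR (L0 - (11 / 8 + l + w) * s%:R))%:E <= post_mass X pi_ rho z setT)%E.
Proof.
move=> q0 qw hq; have q1 : 0 < 1 + q by lra.
pose rr := (rho * (1 + q))^-1.
have rr0 : 0 <= rr by rewrite invr_ge0 mulr_ge0// ltW.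
have rhorr : rho * rr = (1 + q)^-1 by rewrite /rr; field; rewrite !gt_eqF.
have h := @post_mass_ge R n d X pi_ rho z pi0 rho0 v rr (expR (L0 - 11 / 8 * s%:R)) (supp v) rr0 (expR_ge0 _).
apply: le_trans (h _ _); last 2 first.
- move=> u uS uSc.
  rewrite -expRD ler_expR.
  have us : (l0norm u <= s)%N.
    apply: subset_leq_card; apply/fintype.subsetP => j; rewrite !inE.
    by apply: contraNN => vj; apply/eqP/uSc; rewrite ffunE vj.
  have hl1 : l1norm u <= s%:R * rr.
    rewrite -(wt_supp v); apply: (sum_box (f := Num.norm)) => //; exact: normr0.
  have hl2 : l2norm u ^+ 2 <= s%:R * rr ^+ 2.
    rewrite -(wt_supp v) sqr_l2norm; apply: (sum_box (f := fun x => x ^+ 2)) => //.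
      by rewrite expr0n.
    move=> j /uS uj; rewrite -[leLHS]real_normK ?num_real//.
    by rewrite ler_sqr ?nnegrE.
  have := loglik_penalized_ge u (ltW rho0) hsc.
  have h1 : 5 / 4 * rho * l1norm u <= 5 / 4 * s%:R.
    rewrite -mulrA; apply: ler_wpM2l; first by lra.
    apply: le_trans (ler_wpM2l (ltW rho0) hl1) _.
    by rewrite mulrCA rhorr ler_piMr// invf_le1//; lra.
  have h2 : quad (X^T *m X) u <= s%:R.
    apply: le_trans (hq u us) _.
    apply: le_trans (_ : 64 * Xn ^+ 2 * l * q * (n%:R * (s%:R * rr ^+ 2)) <= _).
      apply: ler_wpM2l; last by rewrite ler_wpM2l.
      by apply: mulr_ge0 => //; apply: mulr_ge0; [rewrite mulr_ge0 ?sqr_ge0|exact: ltW].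
    have -> : 64 * Xn ^+ 2 * l * q * (n%:R * (s%:R * rr ^+ 2)) =
        s%:R * (4 * q * (rho * rr) ^+ 2).
      rewrite !exprMn sqr_sqrtr ?mulr_ge0 ?(ltW l0)//; ring.
    rewrite rhorr ler_piMr// exprVn ler_pdivrMr ?exprn_gt0// mul1r.
    rewrite -subr_ge0 (_ : _ - _ = (1 - q) ^+ 2); last by ring.
    exact: sqr_ge0.
  rewrite mulrBr; lra.
- by move=> j; rewrite ffunE negbK => /eqP.
rewrite lee_fin wt_supp rhorr hpi wt_supp.
rewrite (_ : L0 - _ = (L0 - 11 / 8 * s%:R) + (- (s%:R * l) - s%:R * w)); last by ring.
rewrite [expR (_ + _)]expRD [expR (_ - s%:R * w)]expRD -!mulrA; apply: ler_wpM2l; first exact: g0.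
rewrite [leRHS]mulrA [leRHS]mulrC; apply: ler_wpM2l; first exact: expR_ge0.
rewrite !expRN !expRM_natl expRl; apply: ler_pM; rewrite ?invr_ge0 ?exprn_ge0 ?expR_ge0//.
  rewrite lef_pV2 ?posrE ?exprn_gt0 ?ltr0n ?bin_gt0//.
  by rewrite -natrX ler_nat bin_le_expn.
rewrite exprVn lef_pV2 ?posrE ?exprn_gt0 ?expR_gt0//.
by apply: lerXn2r; rewrite ?nnegrE ?expR_ge0// ltW.
Qed.

Lemma measurable_l0norm_ge (x : R) : measurable [set u : 'cV[R]_d | x <= (l0norm u)%:R].
Proof.
have mf : measurable_fun [set: 'cV[R]_d] (fun u => (l0norm u)%:R : measurableTypeR R).
  have -> : (fun u : 'cV[R]_d => (l0norm u)%:R : R) =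
      (fun u => \sum_(j < d) \1_(~` [set 0]) (u j 0)).
    apply/funext => u; rewrite /l0norm -sum1_card natr_sum big_mkcond/=.
    apply: eq_bigr => j _; rewrite inE indicE in_setC in_set1.
    by case: eqP.
  apply: measurable_sum => j.
  apply: (@measurableT_comp _ _ _ _ (measurableTypeR R) (measurableTypeR R) (\1_(~` [set 0]) : R -> R) setT (fun u : 'cV[R]_d => u j 0)); last exact: (@measurable_mx_entry _ R).
  by apply: measurable_indic; apply: measurableC; exact: measurable_set1.
have := mf measurableT _ (measurable_itv `[x, +oo[).
by rewrite setTI; congr measurable; apply/seteqP; split => u /=; rewrite in_itv/= andbT.
Qed.

Lemma integrand_le (E a : R) (u : 'cV[R]_d) :
  loglik X z u - loglik X z v + rho * (l1norm v - l1norm u) <= E - a * l1norm (u - v) ->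
  expR (loglik X z u) * expR (- (rho * l1norm u)) <=
  expR (L0 + E) * expR (- (a * l1norm (u - v))).
Proof. by move=> h; rewrite -!expRD ler_expR; rewrite mulrBr in h; lra. Qed.

(** Applying [prior_tail_le] from [m = s] produces the same weight [g s] as the denominator, so it
    cancels and only exponents remain to be compared. Keeping [rho / 2] in the exponent gives
    [K = 2]. *)
Lemma posterior_sparsity (q E zt : R) : 0 <= q -> s%:R <= zt ->
  (forall u : 'cV[R]_d, (l0norm u <= s)%N ->
    quad (X^T *m X) u <= 64 * Xn ^+ 2 * l * q * (n%:R * l2norm u ^+ 2)) ->
  (forall u : 'cV[R]_d,
    7 / 4 * rho * l1norm (Defs.mask u (supp v)) -
    rho / 4 * l1norm (Defs.mask u (compl (supp v))) - divergence X v u <= E) ->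
  l + (l + q + ln (4 * expR 1)) * s%:R + E <= l * (c4 / 2 * (zt - s%:R)) ->
  posterior X pi_ rho z [set u : 'cV[R]_d | zt <= (l0norm u)%:R] <= 2 / d%:R.
Proof.
move=> q0 szt hq hE hzt.
have den := denominator_ge q0 (expR_ge1Dx q) hq.
have mB := measurable_l0norm_ge zt; set B := [set u | _] in mB *.
have gs := prior_gt0 c10 c20 d0 g0 g1 hg sd.
have num := @post_mass_le R n d X pi_ rho z pi0 rho0 B v (rho / 2) (expR (L0 + E))
  (fun delta => zt <= (wt delta)%:R) mB (divr_gt0 rho0 (ltr0Sn _ 1)) (expR_ge0 _).
have {}num : (post_mass X pi_ rho z B <=
   (expR (L0 + E) * (2 * g s * 2 ^+ s * expR (- (l * (c4 / 2 * (zt - s%:R))))))%:E)%E.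
  apply: le_trans (num _ _) _.
  - move=> delta; rewrite -ltNge => dz u /= zu.
    by rewrite -(ltr_nat R) (lt_le_trans dz).
  - move=> u _; apply: integrand_le.
    have := loglik_penalized_le (u - v) (ltW rho0) hsc.
    rewrite (_ : v + (u - v) = u); last by rewrite addrC subrK.
    by have := hE (u - v); lra.
  rewrite lee_fin ler_wpM2l ?expR_ge0//.
  rewrite (_ : rho / (rho / 2) = 2); last by rewrite invf_div mulrCA divff ?mulr1// gt_eqF.
  rewrite (sum_prior hpi (fun k => zt <= k%:R)).
  by apply: (prior_tail_le c20 c40 d0 g0 hg hd) => //; apply/andP; split; lra.
apply: le_trans (posterior_le pi0 rho0 mB _ num den) _.
  by rewrite mulr_gt0// expR_gt0.
rewrite ler_pdivrMr ?mulr_gt0 ?expR_gt0//.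
have -> : 2 / d%:R = 2 * expR (- l) :> R by rewrite expRN expRl.
have -> : 2 ^+ s = expR (s%:R * ln 2) :> R by rewrite expRM_natl lnK// posrE.
rewrite (_ : _ * (2 * g s * _ * _) = 2 * g s * (expR (L0 + E) * expR (s%:R * ln 2) * expR (- (l * (c4 / 2 * (zt - s%:R)))))); last by ring.
rewrite [leRHS](_ : _ = 2 * g s * (expR (- l) * expR (L0 - (11 / 8 + l + q) * s%:R))); last by ring.
apply: ler_wpM2l; first by rewrite mulr_ge0// ltW.
rewrite -!expRD ler_expR.
(* The loss [11 / 8] on the box and the [ln 2] from [2 ^+ s] are what the term [ln (4 * expR 1)] of
   [zeta] pays for. *)
have ln4e : 11 / 8 + ln 2 <= ln (4 * expR 1) :> R.
  rewrite lnM ?posrE ?expR_gt0// expRK (_ : 4 = 2 * 2); last by ring.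
  rewrite lnM ?posrE//.
  suff : 2^-1 <= ln 2 :> R by lra.
  rewrite -ler_expR lnK ?posrE// -[leLHS]invrK -expRN.
  rewrite -[leRHS]invrK lef_pV2 ?posrE ?expR_gt0//.
  by apply: le_trans (expR_ge1Dx _); lra.
have := ler_wpM2r (ler0n R s) ln4e.
lra.
Qed.

(** In units of [l * maxn s 1], [c3 + 7] collects [c3 + 1] for [g 0 / g s], 5 for the denominator
    (with [11 / 8 <= 2 * l] and [w = 2 * l]) and 1 for the factor [1 / d]. The [maxn] keeps that
    last unit when [s = 0]. *)
Lemma posterior_contraction (q M : R) (C : set 'cV[R]_d) : 0 <= q -> q <= d%:R ->
  c3 + 7 <= M -> 0 < c3 -> c1^-1 <= d%:R -> measurable C ->
  (forall u : 'cV[R]_d, (l0norm u <= s)%N ->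
    quad (X^T *m X) u <= 64 * Xn ^+ 2 * l * q * (n%:R * l2norm u ^+ 2)) ->
  (forall u : 'cV[R]_d, C (v + u) ->
    - (rho / 2) * l1norm u + 7 / 4 * rho * l1norm (Defs.mask u (supp v)) -
    rho / 4 * l1norm (Defs.mask u (compl (supp v))) - divergence X v u <=
    - (rho / 4) * l1norm u - M * (maxn s 1)%:R * l) ->
  posterior X pi_ rho z C <= 2 / d%:R.
Proof.
move=> q0 qd cM c30 c1d mC hq hE.
have qw : 1 + q <= expR (2 * l).
  rewrite mulr_natl mulr2n expRD expRl.
  have d2 : 2 <= d%:R :> R by rewrite ler_nat.
  nra.
have den := denominator_ge q0 qw hq.
have gs := prior_gt0 c10 c20 d0 g0 g1 hg sd.
have num := @post_mass_le R n d X pi_ rho z pi0 rho0 C v (rho / 4) (expR (L0 - M * (maxn s 1)%:R * l))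
  xpredT mC (divr_gt0 rho0 (ltr0Sn _ 3)) (expR_ge0 _).
have {}num : (post_mass X pi_ rho z C <=
   (expR (L0 - M * (maxn s 1)%:R * l) * (2 * (expR ((c3 + 1) * l * s%:R) * g s)))%:E)%E.
  apply: le_trans (num _ _) _ => //.
  - move=> u Cu; apply: integrand_le.
    have := loglik_penalized_le (u - v) (ltW rho0) hsc.
    have := hE (u - v); rewrite (_ : v + (u - v) = u); last by rewrite addrC subrK.
    by move=> /(_ Cu); lra.
  rewrite lee_fin ler_wpM2l ?expR_ge0//.
  rewrite (_ : rho / (rho / 4) = 4); last by rewrite invf_div mulrCA divff ?mulr1// gt_eqF.
  rewrite (sum_prior hpi xpredT).
  (* With [m = 0] and threshold 0 the tail is the whole sum, and the bound is [2 * g 0]. *)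
  have := @prior_tail_le R d c1 c2 c3 c4 g c20 c40 d0 g0 hg hd 0 0 4 (leq0n _) (lexx _).
  rewrite expr0 mulr1 subrr !mulr0 oppr0 expR0 mulr1 => tail.
  apply: le_trans (_ : 2 * g 0%N <= _).
    apply: le_trans (tail _); last by apply/andP; split; lra.
    by rewrite [leRHS](eq_bigl xpredT)// => k; rewrite ler0n.
  rewrite ler_pM2l//; apply: le_trans (prior0_le c10 d0 hg sd) _.
  apply: ler_wpM2r; first exact: ltW.
  rewrite [_ * s%:R]mulrC expRM_natl.
  apply: lerXn2r; rewrite ?nnegrE ?expR_ge0//.
    by rewrite divr_ge0 ?powR_ge0// ltW.
  rewrite mulrDl mul1r expRD expRl; apply: ler_pM => //.
  - by rewrite invr_ge0 ltW.
  - by rewrite /powR gt_eqF.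
apply: le_trans (posterior_le pi0 rho0 mC _ num den) _.
  by rewrite mulr_gt0// expR_gt0.
rewrite ler_pdivrMr ?mulr_gt0 ?expR_gt0//.
have -> : 2 / d%:R = 2 * expR (- l) :> R by rewrite expRN expRl.
rewrite [leLHS](_ : _ = 2 * g s * (expR (L0 - M * (maxn s 1)%:R * l) * expR ((c3 + 1) * l * s%:R))); last by ring.
rewrite [leRHS](_ : _ = 2 * g s * (expR (- l) * expR (L0 - (11 / 8 + l + 2 * l) * s%:R))); last by ring.
apply: ler_wpM2l; first by rewrite mulr_ge0// ltW.
rewrite -!expRD ler_expR.
set m : R := (maxn s 1)%:R.
have m1 : 1 <= m by rewrite ler1n leq_maxr.
have sm : s%:R <= m by rewrite ler_nat leq_maxl.
suff : (c3 + 1) * l * s%:R + l + (11 / 8 + l + 2 * l) * s%:R <= M * m * l by lra.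
have h1 : (c3 + 7) * m * l <= M * m * l.
  by rewrite ler_pM2r// ler_wpM2r// (le_trans _ m1).
apply: le_trans h1.
have h2 : 11 / 8 * s%:R <= 2 * l * s%:R by rewrite ler_wpM2r//; have := l1; lra.
have h3 : (c3 + 6) * l * s%:R <= (c3 + 6) * l * m.
  by apply: ler_wpM2l => //; rewrite mulr_ge0 ?(ltW l0)//; lra.
have h4 : l <= l * m by rewrite ler_peMr// ltW.
lra.
Qed.

End deterministic.

(** * Concentration of the score and expectation over the data *)

Section bernoulli.
Context {R : realType} {n d : nat}.
Variables (X : 'M[R]_(n, d)) (v : 'cV[R]_d).
Local Notation Xn := (mx_norm X).
Implicit Types (z : {ffun 'I_n -> bool}).

Let p i : R := sigmoid ((X *m v) i 0).

Definition bernoulli_weight z : R := \prod_(i < n) (if z i then p i else 1 - p i).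

Lemma bernoulli_weight_ge0 z : 0 <= bernoulli_weight z.
Proof.
apply: prodr_ge0 => i _; case: (z i); first by rewrite ltW// sigmoid_gt0.
by rewrite subr_ge0 ltW// sigmoid_lt1.
Qed.

(** Independence appears as distributivity of the product over the sum on outcomes; each factor is a
    centered Bernoulli generating function, the exponential of [breg]. *)
Lemma bernoulli_mgf (a : 'I_n -> R) :
  \sum_z bernoulli_weight z * expR (\sum_(i < n) ((z i)%:R - p i) * a i) =
  expR (\sum_(i < n) breg ((X *m v) i 0) (a i)).
Proof.
pose F (i : 'I_n) (b : bool) : R :=
  (if b then p i else 1 - p i) * expR ((b%:R - p i) * a i).
transitivity (\prod_(i < n) \sum_b F i b).
  rewrite bigA_distr_bigA; apply: eq_bigr => z _.
  by rewrite expR_sum /bernoulli_weight -big_split.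
rewrite expR_sum; apply: eq_bigr => i _.
rewrite big_bool /F expR_breg -/(p i) [RHS]mulrDl.
rewrite (_ : (true%:R - p i) * a i = a i - p i * a i); last by rewrite mulrBl mul1r.
rewrite (_ : (false%:R - p i) * a i = - (p i * a i)); last by rewrite mulrBl mul0r sub0r.
by rewrite /= [expR (a i - _)]expRD mulrA [LHS]addrC.
Qed.

Lemma sum_bernoulli_weight : \sum_z bernoulli_weight z = 1.
Proof.
have := bernoulli_mgf (fun=> 0).
rewrite [RHS](_ : _ = 1); last by rewrite big1 ?expR0// => i _; exact: breg0.
move=> <-; apply: eq_bigr => z _.
by rewrite big1 ?expR0 ?mulr1// => i _; rewrite mulr0.
Qed.

(** Chernoff's bound with Hoeffding's lemma [breg_le]; the sign [e] covers both tails. *)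
Lemma score_tail (j : 'I_d) (e t lam : R) : `|e| = 1 -> 0 <= lam ->
  \sum_(z : {ffun 'I_n -> bool} | t < e * score X v z j) bernoulli_weight z <=
  expR (lam ^+ 2 * (n%:R * Xn ^+ 2) / 8 - lam * t).
Proof.
move=> e1 lam0.
have e2 : e ^+ 2 = 1 by rewrite -real_normK ?num_real// e1 expr1n.
pose a i := lam * e * X i j.
apply: le_trans (_ : \sum_z bernoulli_weight z * expR (\sum_(i < n) ((z i)%:R - p i) * a i) * expR (- (lam * t)) <= _).
  rewrite big_mkcond; apply: ler_sum => z _.
  rewrite -mulrA -expRD; case: ifPn => [tz|_]; last first.
    by rewrite mulr_ge0 ?bernoulli_weight_ge0 ?expR_ge0.
  rewrite ler_peMr ?bernoulli_weight_ge0// -[leLHS]expR0 ler_expR.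
  have -> : \sum_(i < n) ((z i)%:R - p i) * a i = lam * (e * score X v z j).
    rewrite /score !mulr_sumr; apply: eq_bigr => i _.
    by rewrite /a /p; ring.
  by rewrite subr_ge0 ler_wpM2l// ltW.
rewrite -mulr_suml bernoulli_mgf expRD ler_wpM2r ?expR_ge0// ler_expR.
apply: le_trans (_ : \sum_(i < n) lam ^+ 2 * Xn ^+ 2 / 8 <= _); last first.
  rewrite sumr_const card_ord -[_ *+ n]mulr_natl le_eqVlt; apply/orP; left; apply/eqP.
  by ring.
apply: ler_sum => i _; apply: le_trans (breg_le _ _) _.
rewrite ler_pM2r ?invr_gt0// /a !exprMn e2 mulr1 ler_wpM2l ?sqr_ge0//.
by rewrite -[leLHS]real_normK ?num_real// ler_sqr ?nnegrE ?mx_norm_ge0 ?le_mx_norm.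
Qed.

(** The choice of [rho] makes the optimal Chernoff exponent [- 2 * l], so each of the [2 * d] tails
    has probability at most [d^(- 2)], and a union bound concludes. *)
Lemma score_event (l : R) : (0 < n)%N -> 0 < Xn -> 0 < l -> expR l = d%:R ->
  \sum_(z : {ffun 'I_n -> bool} |
      ~~ [forall j, `|score X v z j| <= 4 * Xn * Num.sqrt (n%:R * l) / 4])
    bernoulli_weight z <= 2 / d%:R.
Proof.
move=> n0 X0 l0 ld.
set t := 4 * Xn * Num.sqrt (n%:R * l) / 4.
have nR : 0 < n%:R :> R by rewrite ltr0n.
have tE : t = Xn * Num.sqrt (n%:R * l) by rewrite /t; field.
have r0 : 0 < Num.sqrt (n%:R * l) by rewrite sqrtr_gt0 mulr_gt0.
have t2 : t ^+ 2 = n%:R * Xn ^+ 2 * l.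
  by rewrite tE exprMn sqr_sqrtr; [ring|rewrite mulr_ge0// ltW].
(* The minimizer in [lam] of the exponent of [score_tail]. *)
pose lam := 4 * t / (n%:R * Xn ^+ 2).
have t0 : 0 < t by rewrite tE mulr_gt0.
have lam0 : 0 <= lam.
  by apply/ltW; rewrite divr_gt0 ?mulr_gt0 ?exprn_gt0.
have expo : lam ^+ 2 * (n%:R * Xn ^+ 2) / 8 - lam * t = - l - l.
  transitivity (- 2 * t ^+ 2 / (n%:R * Xn ^+ 2)).
    by rewrite /lam; field; rewrite !gt_eqF.
  by rewrite t2; field; rewrite !gt_eqF.
have tail (j : 'I_d) (e : R) : `|e| = 1 ->
    \sum_(z : {ffun 'I_n -> bool} | t < e * score X v z j) bernoulli_weight z <= d%:R^-1 / d%:R.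
  move=> e1; apply: le_trans (score_tail j t e1 lam0) _.
  by rewrite expo expRD expRN ld.
apply: le_trans (_ : \sum_(j < d) \sum_(z : {ffun 'I_n -> bool})
    ((if t < 1 * score X v z j then bernoulli_weight z else 0) +
     (if t < -1 * score X v z j then bernoulli_weight z else 0)) <= _).
  rewrite exchange_big/= big_mkcond/=; apply: ler_sum => z _.
  have w0 := bernoulli_weight_ge0 z.
  case: ifPn => [|_]; last first.
    by apply: sumr_ge0 => j _; apply: addr_ge0; case: ifP.
  rewrite negb_forall => /existsP[j]; rewrite -ltNge => tj.
  rewrite (bigD1 j)//=; apply: le_trans (_ : _ <= (if t < 1 * score X v z j then bernoulli_weight z else 0) +
     (if t < -1 * score X v z j then bernoulli_weight z else 0)) _; last first.
    by rewrite lerDl; apply: sumr_ge0 => k _; apply: addr_ge0; case: ifP.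
  rewrite mul1r mulN1r; move: tj; have [s0|s0] := leP 0 (score X v z j).
    by rewrite ger0_norm// => ->; rewrite lerDl; case: ifP.
  by rewrite ltr0_norm// => ->; rewrite lerDr; case: ifP.
apply: le_trans (_ : \sum_(j < d) 2 * (d%:R^-1 / d%:R) <= _).
  apply: ler_sum => j _; rewrite big_split/= -!big_mkcond/= mulr_natl mulr2n.
  by apply: lerD; apply: tail; rewrite ?normrN normr1.
rewrite sumr_const card_ord -[_ *+ d]mulr_natl le_eqVlt; apply/orP; left; apply/eqP.
by field; rewrite -ld gt_eqF// expR_gt0.
Qed.

Lemma bernoulli_mean_le (f : {ffun 'I_n -> bool} -> R) (E : pred {ffun 'I_n -> bool}) (b c : R) :
  (forall z, f z <= 1) -> 0 <= b -> (forall z, E z -> f z <= b) ->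
  \sum_(z | ~~ E z) bernoulli_weight z <= c ->
  \sum_z bernoulli_weight z * f z <= c + b.
Proof.
move=> f1 b0 fb Ec; rewrite (bigID E)/= addrC; apply: lerD.
  apply: le_trans Ec; apply: ler_sum => z _.
  by rewrite ler_piMr ?bernoulli_weight_ge0.
apply: le_trans (_ : \sum_(z | E z) bernoulli_weight z * b <= _).
  by apply: ler_sum => z Ez; rewrite ler_wpM2l ?bernoulli_weight_ge0 ?fb.
rewrite -mulr_suml ler_piMl// -sum_bernoulli_weight [leRHS](bigID E)/= lerDl.
by apply: sumr_ge0 => z _; exact: bernoulli_weight_ge0.
Qed.

Context (disp : measure_display) (T : measurableType disp) (P : probability T R).
Variable Z : 'I_n -> {RV P >-> bool}.
Hypotheses (hZ : mutually_independent Z)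
  (hp : forall i, P [set w | Z i w = true] = (p i)%:E).

Let A z : set T := \bigcap_(i in [set` [set: 'I_n]%SET]) (Z i @^-1` [set z i]).

Let measurable_A z : measurable (A z).
Proof.
apply: fin_bigcap_measurable => // i _.
by rewrite -[_ @^-1` _]setTI; apply: measurable_funP.
Qed.

Lemma law_bernoulli z : P (A z) = (bernoulli_weight z)%:E.
Proof.
rewrite hZ// /bernoulli_weight -prodEFin; apply: eq_big => [i|i _].
  by rewrite finset.in_setT.
have hpi := hp i.
case: (z i); first exact: hpi.
rewrite (_ : Z i @^-1` [set false] = ~` (Z i @^-1` [set true])); last first.
  by apply/seteqP; split => w /=; case: (Z i w).
rewrite probability_setC; last by rewrite -[_ @^-1` _]setTI; apply: measurable_funP.
by rewrite EFinB -hpi.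
Qed.

(** The data take finitely many values, so the integrand is a finite combination of indicators of
    the atoms [A z], and the expectation becomes a weighted sum over outcomes. *)
Lemma expectation_bernoulli (f : ('I_n -> bool) -> R) :
  (forall z, 0 <= f z) ->
  ('E_P[(fun w => f (fun i => Z i w))] = (\sum_z bernoulli_weight z * f z)%:E)%E.
Proof.
move=> f0; rewrite unlock.
have fE w : ((f (fun i => Z i w))%:E =
    \sum_(z : {ffun 'I_n -> bool}) (f z * \1_(A z) w)%:E)%E.
  pose z0 := [ffun i => Z i w].
  rewrite (bigD1 z0)//= [X in (_ + X)%E]big1 ?adde0.
    rewrite indicE mem_set ?mulr1; last by move=> i _ /=; rewrite ffunE.
    by congr (f _)%:E; apply/funext => i; rewrite ffunE.
  move=> z zz0; rewrite indicE memNset ?mulr0// => Az.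
  move/eqP: zz0; apply; apply/ffunP => i; rewrite ffunE.
  by have := Az i; rewrite /= finset.in_setT => ->.
under eq_integral do rewrite fE.
rewrite ge0_integral_sum//; last 2 first.
- by move=> z; apply/measurable_EFinP; exact: measurable_funM.
- by move=> z w _; rewrite lee_fin mulr_ge0.
rewrite -sumEFin; apply: eq_bigr => z _.
under eq_integral do rewrite EFinM.
rewrite ge0_integralZl//.
- have -> : (\int[P]_x (\1_(A z) x)%:E = (bernoulli_weight z)%:E)%E.
    by rewrite integral_indic// setIT; exact: law_bernoulli.
  by rewrite -EFinM mulrC.
- exact/measurable_EFinP.
- by rewrite lee_fin.
Qed.

End bernoulli.

(** * The restricted eigenvalue hypotheses put to work *)

Section main.
Context {R : realType} {n d : nat}.
Variables (X : 'M[R]_(n, d)) (v : 'cV[R]_d).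
Variables (c1 c2 c3 c4 : R) (g : nat -> R) (pi_ : {ffun 'I_d -> bool} -> R).
Hypotheses (c10 : 0 < c1) (c20 : 0 < c2) (c30 : 0 < c3) (c40 : 0 < c4).
Hypotheses (g0 : forall s, (s <= d)%N -> 0 <= g s)
  (g1 : \sum_(0 <= s < d.+1) g s = 1)
  (hg : forall s, (1 <= s <= d)%N ->
    c1 / d%:R `^ c3 * g s.-1 <= g s <= c2 / d%:R `^ c4 * g s.-1)
  (hpi : forall delta, pi_ delta = g (wt delta) / 'C(d, wt delta)%:R)
  (hd : 8 * c2 <= d%:R `^ (c4 / 2)) (hc1 : c1^-1 <= d%:R) (d1 : (1 < d)%N)
  (l1 : 1 <= @ln R d%:R).

Local Notation Xn := (mx_norm X).
Local Notation l := (@ln R d%:R).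
Local Notation r := (Num.sqrt (n%:R * l)).
Local Notation rho := (4 * Xn * r).
Local Notation s := (l0norm v).
Local Notation sb := (sbar c4 X v).
Local Notation zt := (zeta c4 X v).
Local Notation KC := (fine (kappa1_cone X v)).
Local Notation KL := (fine (kappa1_lower X v sb)).
Local Notation KU := (fine (kappa1_upper X s)).
Local Notation kappa := (Order.min (kappa1_cone X v) (kappa1_lower X v sb)).

Hypotheses (kappa0 : (0 < kappa)%E)
  (hn : 140 ^+ 2 * Xn ^+ 4 * (s%:R / fine kappa) ^+ 2 * l <= n%:R).

Let l0 : 0 < l. Proof. exact: lt_le_trans l1. Qed.

Let d0 : (0 < d)%N. Proof. exact: ltnW. Qed.

Let kC0 : (0 < kappa1_cone X v)%E.
Proof. by move: kappa0; rewrite lt_min => /andP[]. Qed.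

Let kL0 : (0 < kappa1_lower X v sb)%E.
Proof. by move: kappa0; rewrite lt_min => /andP[]. Qed.

Let vneq0 : (0 < s)%N -> v != 0.
Proof. by rewrite lt0n l0norm_eq0. Qed.

Let KC0 : (0 < s)%N -> 0 < KC.
Proof.
move=> s0; apply: fine_gt0; rewrite kC0/=.
by apply: le_lt_trans (kappa1_cone_le X (vneq0 s0)) _; exact: ltry.
Qed.

Let KU0 : 0 <= KU.
Proof.
have [s0|s0] := posnP s.
  (* The supremum over the empty set is [-oo], which [fine] sends to 0. *)
  rewrite s0 (_ : kappa1_upper X 0 = -oo%E)//.
  rewrite /kappa1_upper (_ : [set _ | _] = set0) ?image_set0 ?ereal_sup0//.
  by apply/seteqP; split => // u /=; rewrite leqn0 lt0n => /andP[/negP].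
apply: fine_ge0.
have [n0|n0] := posnP n; last by have /andP[] := kappa1_upper_bounds X s0 d0 n0.
have h : ((rayleigh (n := n) (X^T *m X) v)%:E <= kappa1_upper X s)%E.
  by apply: ereal_sup_ubound; exists v => //=; rewrite leqnn s0.
apply: le_trans h; rewrite lee_fin /rayleigh.
by rewrite divr_ge0 ?quad_gram_ge0// mulr_ge0 ?sqr_ge0.
Qed.

(* [E1] and [q] below turn the terms of [zeta] into bounds: [l * Y * s] pays for the
   model-size prior ([l]), the cone ([E1]), the box radius ([q]) and
   the constant factor per coordinate ([ln (4 * expR 1)]). *)
Let Y : R := 1 + 64 * Xn ^+ 2 / KC + KU / (64 * Xn ^+ 2 * l ^+ 2) + ln (4 * expR 1) / l.

Let Ys0 : 0 <= Y * s%:R.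
Proof.
have [->|s0] := posnP s; first by rewrite mulr0.
have X64 : 0 <= 64 * Xn ^+ 2 by rewrite mulr_ge0 ?sqr_ge0.
have ln4e : 0 <= ln (4 * expR 1) :> R.
  by apply: ln_ge0; have := expR_ge1Dx (1 : R); lra.
apply: mulr_ge0 => //; apply: addr_ge0; last by rewrite divr_ge0// ltW.
apply: addr_ge0; last by rewrite divr_ge0// mulr_ge0 ?sqr_ge0.
by rewrite addr_ge0// divr_ge0// ltW// KC0.
Qed.

Let ztE : zt = s%:R + 2 / c4 * (1 + Y * s%:R).
Proof. by rewrite /zeta -/Y; ring. Qed.

Let s_le_zt : s%:R <= zt.
Proof.
rewrite ztE lerDl mulr_ge0 ?divr_ge0 ?(ltW c40)//.
by have := Ys0; lra.
Qed.

Let zt0 : 0 < zt.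
Proof.
rewrite ztE ltr_wpDl// mulr_gt0 ?divr_gt0//.
by have := Ys0; lra.
Qed.

Let sbE : s%:R + zt <= sb%:R.
Proof.
rewrite /sbar; apply: le_trans (ceil_ge _) _.
rewrite -[leRHS]/((`|Num.ceil (s%:R + zt)|%N : int)%:~R) ler_int.
exact: ler_norm.
Qed.

Let sb0 : (0 < sb)%N.
Proof. by rewrite -(ltr_nat R); apply: lt_le_trans sbE; rewrite ltr_wpDl. Qed.

Let n0 : (0 < n)%N. Proof. exact: kappa1_lower_n_gt0 kL0. Qed.

Let nR : 0 < n%:R :> R. Proof. by rewrite ltr0n. Qed.

Let kL_le : (kappa1_lower X v sb <= (Xn ^+ 2 / 4)%:E)%E.
Proof. exact: kappa1_lower_le. Qed.

Let kL_fin : kappa1_lower X v sb \is a fin_num.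
Proof. by rewrite gt0_fin_numE// (le_lt_trans kL_le)// ltry. Qed.

Let KL0 : 0 < KL.
Proof. by rewrite fine_gt0// kL0/= (le_lt_trans kL_le)// ltry. Qed.

Let KL_le : 4 * KL <= Xn ^+ 2.
Proof.
have : KL <= Xn ^+ 2 / 4 by rewrite -lee_fin fineK.
by lra.
Qed.

Let X0 : 0 < Xn.
Proof.
rewrite lt0r mx_norm_ge0 andbT; apply/eqP => Xn0.
by have := KL_le; have := KL0; rewrite Xn0 expr0n/=; lra.
Qed.

Let k_fin : kappa \is a fin_num.
Proof. by rewrite gt0_fin_numE// (le_lt_trans _ (le_lt_trans kL_le (ltry _)))// ge_min lexx orbT. Qed.

Let k0 : 0 < fine kappa.
Proof. by rewrite fine_gt0// kappa0/= -ge0_fin_numE// ltW. Qed.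

Let k_le_KL : fine kappa <= KL.
Proof. by rewrite fine_le// ge_min lexx orbT. Qed.

Let k_le_KC : (0 < s)%N -> fine kappa <= KC.
Proof.
move=> s0; rewrite fine_le//; last by rewrite ge_min lexx.
by rewrite gt0_fin_numE// (le_lt_trans (kappa1_cone_le X (vneq0 s0)))// ltry.
Qed.

Let r0 : 0 < r. Proof. by rewrite sqrtr_gt0 mulr_gt0. Qed.

Let r2 : r ^+ 2 = n%:R * l.
Proof. by rewrite sqr_sqrtr// mulr_ge0// ltW. Qed.

(** The sample-size hypothesis reads [W ^+ 2 * l <= n]. As [r] is the geometric mean of [n] and [l],
    it yields both [W * r <= n] and [W * l <= r]. *)
Let W : R := 140 * Xn ^+ 2 * s%:R / fine kappa.

Let W0 : 0 <= W.
Proof. by rewrite divr_ge0 ?(ltW k0)// mulr_ge0// mulr_ge0 ?sqr_ge0. Qed.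

Let W2 : W ^+ 2 * l <= n%:R.
Proof.
apply: le_trans hn; rewrite le_eqVlt; apply/orP; left; apply/eqP.
by rewrite /W; field; rewrite gt_eqF.
Qed.

Let sample_size1 (k : R) : fine kappa <= k -> 140 * Xn ^+ 2 * s%:R * r <= n%:R * k.
Proof.
move=> hk; apply: le_trans (ler_wpM2l (ltW nR) hk).
suff h : W * r <= n%:R.
  have := ler_wpM2r (ltW k0) h; rewrite /W mulrAC divfK//.
  by rewrite gt_eqF.
have Wr0 : 0 <= W * r := mulr_ge0 W0 (ltW r0).
rewrite -ler_sqr ?nnegrE ?Wr0// exprMn r2 mulrCA [leRHS]expr2.
by rewrite ler_pM2l.
Qed.

Let sample_size2 : 140 * Xn ^+ 2 * s%:R * l <= r * KL.
Proof.
apply: le_trans (ler_wpM2l (ltW r0) k_le_KL).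
suff h : W * l <= r.
  have := ler_wpM2r (ltW k0) h; rewrite /W mulrAC divfK//.
  by rewrite gt_eqF.
have Wl0 : 0 <= W * l := mulr_ge0 W0 (ltW l0).
rewrite -ler_sqr ?nnegrE ?Wl0 ?(ltW r0)// exprMn r2 [l ^+ 2]expr2 mulrA.
by rewrite ler_pM2r.
Qed.

Let q : R := if s == 0%N then 0 else KU / (64 * Xn ^+ 2 * l).

Let q0 : 0 <= q.
Proof.
rewrite /q; case: ifP => // _; rewrite divr_ge0// mulr_ge0 ?(ltW l0)//.
by rewrite mulr_ge0 ?sqr_ge0.
Qed.

Let q_le : q <= d%:R.
Proof.
rewrite /q; case: eqVneq => // s0; rewrite -lt0n in s0.
have /andP[k1 k2] := kappa1_upper_bounds X s0 d0 n0.
have kU : KU <= s%:R * Xn ^+ 2.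
  by rewrite -lee_fin fineK// ge0_fin_numE// (le_lt_trans k2)// ltry.
have X2 : 0 < Xn ^+ 2 by rewrite exprn_gt0.
rewrite ler_pdivrMr; last by rewrite !mulr_gt0.
apply: le_trans kU _.
have sd : s%:R <= d%:R :> R by rewrite ler_nat -wt_supp wt_le.
rewrite (_ : d%:R * _ = d%:R * (64 * l) * Xn ^+ 2); last by ring.
rewrite ler_pM2r//; apply: le_trans sd _.
by rewrite ler_peMr//; have := l1; lra.
Qed.

Let hq (u : 'cV[R]_d) : (l0norm u <= s)%N ->
  quad (X^T *m X) u <= 64 * Xn ^+ 2 * l * q * (n%:R * l2norm u ^+ 2).
Proof.
rewrite /q; case: eqVneq => [->|s0] us.
  move: us; rewrite leqn0 l0norm_eq0 => /eqP ->.
  rewrite mulr0 mul0r quad_gram mulmx0 big1// => i _.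
  by rewrite mxE expr0n.
rewrite -lt0n in s0; apply: le_trans (kappa1_upper_quad X s0 d0 n0 us) _.
rewrite [_ * (KU / _)]mulrC divfK// gt_eqF// !mulr_gt0// exprn_gt0//.
Qed.

Let E1 : R := if s == 0%N then 0 else 64 * Xn ^+ 2 * l * s%:R / KC.

Let hE1 (u : 'cV[R]_d) :
  7 / 4 * rho * l1norm (Defs.mask u (supp v)) -
  rho / 4 * l1norm (Defs.mask u (compl (supp v))) - divergence X v u <= E1.
Proof.
have hS := l1norm_mask_le u (supp v); rewrite wt_supp in hS.
have tE := l1norm_maskD u (supp v).
set uS := l1norm (Defs.mask u (supp v)) in hS tE *.
set uSc := l1norm (Defs.mask u (compl (supp v))) in tE *.
have uS0 : 0 <= uS by exact: l1norm_ge0.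
have uSc0 : 0 <= uSc by exact: l1norm_ge0.
have D0 := divergence_ge0 X v u.
have Xr0 : 0 < Xn * r by rewrite mulr_gt0.
have E10 : 0 <= E1.
  rewrite /E1; case: eqVneq => // s0; rewrite -lt0n in s0.
  rewrite divr_ge0 ?(ltW (KC0 s0))// mulr_ge0// mulr_ge0 ?(ltW l0)//.
  by rewrite mulr_ge0 ?sqr_ge0.
have [off|cone] := ltP (7 * uS) uSc.
  have := ler_wpM2l (ltW Xr0) (ltW off); lra.
have [s0|s0] := posnP s.
  have uS00 : uS = 0.
    by apply/eqP; rewrite eq_le uS0 andbT (le_trans hS)// s0 sqrtr0 mul0r.
  by have : 0 <= (Xn * r) * uSc; [rewrite mulr_ge0// ltW|rewrite uS00; lra].
have sR : 0 < s%:R :> R by rewrite ltr0n.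
have hquad := kappa1_cone_quad n0 kC0 cone.
have hdiv := divergence_ge X v u.
set x := l2norm u in hS hquad.
have x0 : 0 <= x by exact: l2norm_ge0.
have qs0 : 0 <= Num.sqrt s%:R :> R by exact: sqrtr_ge0.
pose y := Num.sqrt s%:R * x; have y0 : 0 <= y by rewrite mulr_ge0.
(* With this [b], [c = Xn * r] and [y] bounding [uS] by Cauchy-Schwarz, the value [64 * c ^+ 2 / b]
   of [cone_bound] is exactly [E1], and its hypothesis is the sample-size condition. *)
pose b := n%:R * KC / s%:R.
have b0 : 0 < b by rewrite divr_gt0// mulr_gt0// KC0.
have hb : 140 * (Xn * r * Xn) <= b.
  rewrite ler_pdivlMr//; apply: le_trans (sample_size1 (k_le_KC s0)).
  by rewrite le_eqVlt; apply/orP; left; apply/eqP; ring.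
have := cone_bound b0 (ltW Xr0) (ltW X0) y0 hb.
have -> : 64 * (Xn * r) ^+ 2 / b = E1.
  rewrite /E1 gtn_eqF// exprMn r2 /b; field.
  by rewrite !gt_eqF// KC0.
have : b * y ^+ 2 / (2 + 8 * Xn * y) <= divergence X v u.
  apply: le_trans hdiv; apply: ler_pM.
  - by rewrite mulr_ge0 ?sqr_ge0// ltW.
  - by rewrite invr_ge0 addr_ge0// mulr_ge0// mulr_ge0// ltW.
  - apply: le_trans hquad; rewrite /b /y exprMn sqr_sqrtr ?(ltW sR)//.
    by rewrite le_eqVlt; apply/orP; left; apply/eqP; field; rewrite gt_eqF.
  - rewrite lef_pV2 ?posrE ?ltr_wpDr ?mulr_ge0 ?(ltW X0) ?l1norm_ge0//.
    rewrite lerD2l tE [8 * _]mulrC -mulrA ler_pM2l//.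
    have : uS <= y by [].
    by lra.
have : 7 * (Xn * r) * uS <= 7 * (Xn * r) * y.
  by apply: ler_wpM2l => //; apply: mulr_ge0 => //; exact: ltW.
have : 0 <= (Xn * r) * uSc by rewrite mulr_ge0// ltW.
lra.
Qed.

(** An equality in fact: [zeta] solves it for [zt], and the factor [2 / c4] in it undoes the decay
    rate [c4 / 2] of the prior tail. *)
Let hzt : l + (l + q + ln (4 * expR 1)) * s%:R + E1 <= l * (c4 / 2 * (zt - s%:R)).
Proof.
rewrite ztE (_ : l * _ = l + l * Y * s%:R); last by field; rewrite gt_eqF.
rewrite -addrA lerD2l /q /E1; case: eqVneq => [->|s0]; first by rewrite !mulr0 addr0.
rewrite -lt0n in s0; have K0 := KC0 s0.
rewrite le_eqVlt; apply/orP; left; apply/eqP; rewrite /Y; field.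
by rewrite !gt_eqF.
Qed.

Section fixed_observation.
Variable (z : 'I_n -> bool).
Hypothesis hsc : forall j, `|score X v z j| <= rho / 4.

Lemma posterior_l0norm_ge :
  posterior X pi_ rho z [set u : 'cV[R]_d | zt <= (l0norm u)%:R] <= 2 / d%:R.
Proof.
by apply: (posterior_sparsity c10 c20 c40 g0 g1 hg hpi hd n0 d1 X0 l1 hsc q0 s_le_zt hq hE1 hzt).
Qed.

Lemma measurable_l2norm_gt (c : R) :
  measurable [set u : 'cV[R]_d | c < l2norm (u - v)].
Proof.
have mf : measurable_fun [set: 'cV[R]_d] (fun u => l2norm (u - v) : measurableTypeR R).
  apply: (@measurableT_comp _ _ _ _ (measurableTypeR R) (measurableTypeR R) Num.sqrt setT
    (fun u : 'cV[R]_d => \sum_(j < d) (u - v) j 0 ^+ 2)).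
    apply: continuous_measurable_fun; exact: sqrt_continuous.
  apply: measurable_sum => j; apply: measurable_funX.
  under [F in measurable_fun _ F]eq_fun do rewrite !mxE.
  by apply: measurable_funB => //; exact: (@measurable_mx_entry _ R).
have := mf measurableT _ (measurable_itv `]c, +oo[).
by rewrite setTI; congr measurable; apply/seteqP; split => u /=; rewrite in_itv/= andbT.
Qed.

(** The eigenvalue at [sb] applies only to sparse differences, so models of size at least [zt] are
    split off at cost [2 / d]. For the rest, [theta - theta_s] has at most [s + zt <= sb] nonzero
    entries. *)
Lemma posterior_l2norm_gt (M : R) : 140 <= M -> c3 + 7 <= M ->
  posterior X pi_ rho z [set u : 'cV[R]_d |
    M * Xn / KL * Num.sqrt (sb%:R * l / n%:R) < l2norm (u - v)] <= 4 / d%:R.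
Proof.
move=> M140 c3M; pose eps := M * Xn / KL * Num.sqrt (sb%:R * l / n%:R).
set B := [set u | _].
pose B1 := [set u : 'cV[R]_d | zt <= (l0norm u)%:R].
have mB : measurable B by exact: measurable_l2norm_gt.
have mB1 : measurable B1 by exact: measurable_l0norm_ge.
have mC : measurable (B `\` B1) by exact: measurableD.
have rho0 : 0 < rho by rewrite !mulr_gt0.
have sub : B `<=` B1 `|` (B `\` B1).
  by rewrite setUDr setDv setD0; exact: subsetUr.
apply: le_trans (posteriorU_le X z (prior_ge0 g0 hpi) rho0 mB mB1 mC sub) _.
have -> : 4 / d%:R = 2 / d%:R + 2 / d%:R :> R by rewrite -mulrDl -natrD.
apply: lerD; first exact: posterior_l0norm_ge.
apply: (posterior_contraction c10 c20 c40 g0 g1 hg hpi hd n0 d1 X0 l1 hsc q0 q_le c3M) => //.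
move=> u [Bu nB1u].
have us : (l0norm u <= sb)%N.
  have h : (l0norm u <= l0norm (v + u) + s)%N.
    by have := l0normB (v + u) v; rewrite [v + u]addrC addrK.
  apply: leq_trans h _; rewrite -(ler_nat R) natrD; apply: le_trans sbE.
  by rewrite addrC lerD2l ltW// ltNge; apply/negP.
have {}Bu : eps < l2norm u by move: Bu; rewrite /B/= [v + u]addrC addrK.
apply: (@exponent_bound R Xn r n%:R l KL (l2norm u) (l1norm u)
  (l1norm (Defs.mask u (supp v))) (l1norm (Defs.mask u (compl (supp v))))
  (divergence X v u) M s sb%:R) => //.
- by apply: le_trans sbE; rewrite lerDl ltW.
- by rewrite ler1n.
- exact: l1norm_ge0.
- exact: l1norm_ge0.
- exact: l1norm_maskD.
- by rewrite -(wt_supp v); exact: l1norm_mask_le.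
- exact: l2norm_le_l1norm.
- apply: le_trans (divergence_ge X v u).
  rewrite ler_wpM2r ?invr_ge0 ?addr_ge0 ?mulr_ge0 ?(ltW X0) ?l1norm_ge0//.
  by have := kappa1_lower_quad n0 kL0 us; rewrite mulrA [KL * _]mulrC.
- exact: sample_size1.
Qed.

End fixed_observation.

Lemma prob_score_event :
  \sum_(z : {ffun 'I_n -> bool} | ~~ [forall j, `|score X v z j| <= rho / 4])
    bernoulli_weight X v z <= 2 / d%:R.
Proof. by apply: score_event => //; rewrite lnK// posrE ltr0n. Qed.

Section expectation.
Context (disp : measure_display) (T : measurableType disp) (P : probability T R).
Variable Z : 'I_n -> {RV P >-> bool}.
Hypotheses (hZ : mutually_independent Z)
  (hp : forall i, P [set w | Z i w = true] = (sigmoid ((X *m v) i 0))%:E).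

Lemma expectation_posterior_le (B : set 'cV[R]_d) (b : R) : measurable B -> 0 <= b ->
  (forall z : {ffun 'I_n -> bool}, (forall j, `|score X v z j| <= rho / 4) ->
    posterior X pi_ rho z B <= b) ->
  ('E_P[(fun w => posterior X pi_ rho (fun i => Z i w) B)] <= (2 / d%:R + b)%:E)%E.
Proof.
move=> mB b0 hb; have rho0 : 0 < rho by rewrite !mulr_gt0.
have pi0 := prior_ge0 g0 hpi.
rewrite (expectation_bernoulli hZ hp (f := fun z => posterior X pi_ rho z B)); last first.
  by move=> z; exact: posterior_ge0.
rewrite lee_fin; apply: (bernoulli_mean_le _ b0 _ prob_score_event).
  by move=> z; exact: posterior_le1.
by move=> z /forallP; exact: hb.
Qed.

End expectation.

End main.

Theorem theorem4 (R : realType) :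
  exists A : R,
  forall c1 c2 c3 c4 : R,
    0 < c1 -> 0 < c2 -> 0 < c3 -> 0 < c4 -> c4 <= c3 ->
  exists (d0 : nat) (M0 : R), 2 < M0 /\
  forall (d n : nat) (X : 'M[R]_(n, d)) (theta_s : 'cV[R]_d)
    (disp : measure_display) (T : measurableType disp) (P : probability T R)
    (Z : 'I_n -> {RV P >-> bool})
    (g : nat -> R) (pi_ : {ffun 'I_d -> bool} -> R),
    (d0 <= d)%N ->
    mutually_independent Z ->
    (forall i, P [set w | Z i w = true] =
       (expR ((X *m theta_s) i 0) / (1 + expR ((X *m theta_s) i 0)))%:E) ->
    (forall s, (s <= d)%N -> 0 <= g s) ->
    \sum_(0 <= s < d.+1) g s = 1 ->
    (forall s, (1 <= s <= d)%N ->
       c1 / d%:R `^ c3 * g s.-1 <= g s <= c2 / d%:R `^ c4 * g s.-1) ->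
    (forall delta, pi_ delta = g (wt delta) / 'C(d, wt delta)%:R) ->
    let rho := 4 * mx_norm X * Num.sqrt (n%:R * ln d%:R) in
    let s_s := l0norm theta_s in
    let zt := zeta c4 X theta_s in
    let sb := sbar c4 X theta_s in
    let kappa := Order.min (kappa1_cone X theta_s) (kappa1_lower X theta_s sb) in
    (0 < kappa)%E ->
    A * mx_norm X ^+ 4 * (s_s%:R / fine kappa) ^+ 2 * ln d%:R <= n%:R ->
    ('E_P[(fun w => posterior X pi_ rho (fun i => Z i w)
             [set theta : 'cV[R]_d | zt <= (l0norm theta)%:R])%R]
       <= (4 / d%:R)%:E)%E
    /\
    ('E_P[(fun w => posterior X pi_ rho (fun i => Z i w)
             [set theta : 'cV[R]_d |
                M0 * mx_norm X / fine (kappa1_lower X theta_s sb)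
                  * Num.sqrt (sb%:R * ln d%:R / n%:R)
                < l2norm (theta - theta_s)])%R]
       <= (12 / d%:R)%:E)%E.
Proof.
(* [A] is the square of the constant in [W]. The bound on [d] gives in turn [2 <= d],
   [8 * c2 <= d^(c4 / 2)], [1 / c1 <= d] and [1 <= ln d]; [c3 + 147] exceeds both 140 and
   [c3 + 7]. *)
exists (140 ^+ 2) => c1 c2 c3 c4 c10 c20 c30 c40 _.
exists (2 + Num.bound ((8 * c2) `^ (2 / c4)) + Num.bound c1^-1 + Num.bound (expR 1 : R))%N, (c3 + 147).
split; first by lra.
move=> d n X v disp T P Z g pi_ dd hZ hp g0 g1 hg hpi rho s zt sb kappa kappa0 hn.
have bd (x : R) : 0 <= x -> (Num.bound x <= d)%N -> x <= d%:R.
  by move=> x0 xd; apply: le_trans (ltW (archi_boundP x0)) _; rewrite ler_nat.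
have d2 : (1 < d)%N by apply: leq_trans dd; rewrite -!addnA leq_addr.
have dR : 0 < d%:R :> R by rewrite ltr0n ltnW.
have hd : 8 * c2 <= d%:R `^ (c4 / 2).
  have h : (8 * c2) `^ (2 / c4) <= d%:R.
    apply: bd; first exact: powR_ge0.
    by apply: leq_trans dd; rewrite -!addnA addnCA leq_addr.
  have := ge0_ler_powR (_ : 0 <= c4 / 2) _ _ h.
  rewrite -powRrM (_ : 2 / c4 * (c4 / 2) = 1); last by field; rewrite gt_eqF.
  move=> hp1; rewrite -[leLHS]powRr1; last by rewrite mulr_ge0// ltW.
  apply: hp1.
  - by rewrite divr_ge0// ltW.
  - by rewrite nnegrE powR_ge0.
  - by rewrite nnegrE.
have hc1 : c1^-1 <= d%:R.
  apply: bd; first by rewrite invr_ge0 ltW.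
  by apply: leq_trans dd; rewrite -addnA addnCA leq_addr.
have l1 : 1 <= ln d%:R :> R.
  rewrite -ler_expR lnK ?posrE//; apply: bd; first exact: expR_ge0.
  by apply: leq_trans dd; rewrite leq_addl.
have b2 : 0 <= 2 / d%:R :> R by rewrite divr_ge0.
have b4 : 0 <= 4 / d%:R :> R by rewrite divr_ge0.
split.
  have -> : 4 / d%:R = 2 / d%:R + 2 / d%:R :> R by rewrite -mulrDl -natrD.
  apply: (expectation_posterior_le c40 g0 hpi d2 l1 kappa0 hZ hp _ b2).
    exact: measurable_l0norm_ge.
  move=> z; exact: (posterior_l0norm_ge c10 c20 c40 g0 g1 hg hpi hd d2 l1 kappa0 hn).
(* The score event costs [2 / d] and the posterior bound [4 / d], so the total is [6 / d]. *)
apply: (@le_trans _ _ (2 / d%:R + 4 / d%:R)%:E); last first.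
  by rewrite lee_fin -mulrDl ler_wpM2r ?invr_ge0//; lra.
apply: (expectation_posterior_le c40 g0 hpi d2 l1 kappa0 hZ hp _ b4).
  exact: measurable_l2norm_gt.
move=> z hz; apply: (posterior_l2norm_gt c10 c20 c30 c40 g0 g1 hg hpi hd hc1 d2 l1 kappa0 hn hz); lra.
Qed.
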